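(* Let $p>3$ be a prime. There exist exactly $7$ Bruck loops of order $p^3$ up to isomorphism, and (isomorphism classes of) Bruck loops of order $p^3$ are in one-to-one correspondence with (isomorphism classes of) commutative automorphic loops of order $p^3$.
   Context: A loop is a set with a binary operation having a two-sided identity element and such that all left and right translations are bijections. A Bruck loop is a loop satisfying the (left) Bol identity $x(y(xz))=(x(yx))z$ and the automorphic inverse property $(xy)^{-1}=x^{-1}y^{-1}$. A loop is automorphic if all its inner mappings (the elements of the group generated by all left and right translations that fix the identity element) are automorphisms of the loop; a commutative automorphic loop is an automorphic loop with commutative operation. Abelian groups are included in both classes. *)

(* Defs.v *)
From mathcomp Require Import all_boot fingroup perm action.

Set Implicit Arguments.
Unset Strict Implicit.
Unset Printing Implicit Defensive.

(* A plain record: MathComp's hierarchy has no join of finite types and unital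
   magmas, and one cannot be added on top of the existing finite groups. *)
Record finLoop : Type := FinLoop {
  loop_sort :> finType;
  lmul : loop_sort -> loop_sort -> loop_sort;
  lone : loop_sort;
  lmul1l : left_id lone lmul;
  lmull1 : right_id lone lmul;
  ltrans_bij : forall x, bijective (fun y => lmul x y);
  rtrans_bij : forall x, bijective (fun y => lmul y x)
}.

Declare Scope loop_scope.
Delimit Scope loop_scope with L.
Notation "x * y" := (lmul x y) : loop_scope.
Notation "1" := (lone _) : loop_scope.
Local Open Scope loop_scope.

Section FinLoopTheory.

Variable L : finLoop.
Implicit Types x y z : L.

Definition ltrans x : {perm L} := perm (bij_inj (ltrans_bij x)).
Definition rtrans x : {perm L} := perm (bij_inj (rtrans_bij x)).

Definition mlt_group : {group {perm L}} :=
  <<[set ltrans x | x : L] :|: [set rtrans x | x : L]>>%G.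

(* The stabiliser of the identity element in the multiplication group. *)
Definition inn_group : {group {perm L}} := 'C_mlt_group[lone L | 'P]%G.

Definition left_bol := forall x y z, x * (y * (x * z)) = (x * (y * x)) * z.

(* In a general loop only the one-sided inverses are defined; loop_inv x is
   the right inverse x \ 1, which is two-sided as soon as the left Bol identity
   holds (left_bol_mulV). *)
Definition loop_inv x : L := (ltrans x)^-1%g 1.

Lemma loop_mulV x : x * loop_inv x = 1.
Proof. by have := permKV (ltrans x) 1; rewrite permE. Qed.

Lemma left_bol_mulV x : left_bol -> loop_inv x * x = 1.
Proof.
move=> bol; set y := loop_inv x; have xy : x * y = 1 := loop_mulV x.
apply: (bij_inj (ltrans_bij x)); rewrite lmull1.
by apply: (bij_inj (rtrans_bij y)); rewrite -bol xy lmull1.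
Qed.

Definition automorphic_inverse :=
  forall x y, loop_inv (x * y) = loop_inv x * loop_inv y.

Definition bruck_loop := left_bol /\ automorphic_inverse.

(* Inner mappings are bijective, so being an automorphism amounts to being
   multiplicative. *)
Definition automorphic_loop :=
  forall s : {perm L}, s \in inn_group -> {morph s : x y / x * y}.

Definition commutative_automorphic_loop :=
  commutative (@lmul L) /\ automorphic_loop.

End FinLoopTheory.

Definition loop_isomorphic (L M : finLoop) : Prop :=
  exists2 f : L -> M, bijective f & {morph f : x y / x * y}.

Definition iso_class (L : finLoop) : finLoop -> Prop :=
  fun M => loop_isomorphic L M.

(* Sets of loops are written as predicates, since the universe of finType is
   too large for the sets of mathcomp-classical. *)
Definition iso_classes (P : finLoop -> Prop) (n : nat) : Type :=
  {C : finLoop -> Prop |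
    exists L : finLoop, [/\ P L, #|L| = n & C = iso_class L]}.

(* Main.v *)
(* In a Bruck loop put s_x(y) = x(x y^-1), in a commutative automorphic loop
   put s_x(y) = x(x\y)^-1.  Both are involutory latin quandles.  If such a
   quandle has p^n elements (p odd), a maximal s_1-invariant p-subgroup of
   <s_x> is a Sylow subgroup, transitive on the p^n reflections, so the group O
   generated by the products s_x s_y is a p-group.  The elements of Z(O)
   inverted by s_1 form a nontrivial group Z; either O is abelian, and the loop
   is an abelian group, or |Z| p^2 <= p^n.  For n = 3 the second case yields a
   central element c of order p with L/<c> an abelian group (as n = 2 there).

   Write x(yz) = ((xy)z) c^alpha(x,y,z).  The identities of either class make
   alpha trilinear over F_p, and dividing by 3 (here p > 3 is used) one solves
   alpha = delta f for an explicit f, so that (xy) c^-f(x,y) is the operation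
   of an abelian group E.  Thus the loop is E with
   x + y + iota(s tau(x,y,x) + t tau(x,y,y)), where tau is trilinear,
   alternating in its first two arguments, and (s,t) is (1,2) for Bruck loops
   and (1,-1) for commutative automorphic loops.  Modulo iota one has
   tau(x,y,z) = det(x,y) lambda(z), and p x = iota(mu(x)); the pairs of linear
   forms (lambda, mu) with lambda <> 0 on F_p^2 fall into four orbits: mu = 0,
   mu parallel to lambda, and two for independent forms, according to a square
   class.  With the three abelian groups this makes seven loops, in both
   classes. *)

Require Import Defs.
From HB Require Import structures.
From mathcomp Require Import all_boot all_fingroup all_algebra all_solvable.
From mathcomp Require Import zify ring boolp.

Set Implicit Arguments.
Unset Strict Implicit.
Unset Printing Implicit Defensive.

Local Notation "x ⋅ y" := (lmul x y) (at level 40, left associativity).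
Local Notation e := (lone _).

Local Open Scope group_scope.

(** * Involutory latin quandles of prime power order *)

(** No map from one class to the other is constructed: each class is matched with the same list of
    seven twisted groups, and the correspondence comes from the two counts. The obstacle is
    nilpotency: nothing is known at first about the group generated by the translations. The
    reflections help because products of two of them act semiregularly, so these have p-power order,
    while the centraliser of a reflection has index exactly p^n.

    The pairs (s,t) come from the associator of the twisted operation, t tau(x,y,z) + (t-s)
    tau(x,z,y) - s tau(y,z,x). The defect in the Bol identity is a multiple of t - 2s, and the
    cocycle is symmetric when t = -s. When tau satisfies the Jacobi identity and s = 1, the
    associator becomes 3 tau(x,y,z), respectively -3 tau(x,z,y); this is the origin of the division
    by 3. The invariants that separate the models see s and t only through 2t - s, which is 3 or -3.
    As this is nonzero for p > 3, one list of invariants serves both classes. *)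

Section OddRoots.

Variable gT : finGroupType.
Implicit Types x : gT.

Lemma odd_expg_half x : odd #[x] -> (x ^+ 2) ^+ (#[x].+1)./2 = x.
Proof.
move=> ox; rewrite -expgM mul2n -[RHS]expg1.
have -> : ((#[x].+1)./2).*2 = #[x].+1 by rewrite -[RHS](odd_double_half) /= ox.
by rewrite expgS expg_order mulg1.
Qed.

Lemma odd_sqr1 x : odd #[x] -> x ^+ 2 = 1 -> x = 1.
Proof. by move=> ox x2; rewrite -(odd_expg_half ox) x2 expg1n. Qed.

End OddRoots.

Lemma pnat_odd p n : prime p -> 2 < p -> p.-nat n -> odd n.
Proof.
move=> pr p2 /p_natP [m ->]; rewrite oddX.
by case: (even_prime pr) => [E|->]; [rewrite E in p2 | rewrite orbT].
Qed.

(** Point stabilisers in the cyclic group of [c] are trivial, so [Q] splits into orbits of length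
    [#[c]]. *)
Lemma semiregular_order_dvd (Q : finType) (c : {perm Q}) :
  (forall k z, (c ^+ k) z = z -> c ^+ k = 1) -> #[c] %| #|Q|.
Proof.
move=> free.
have tr (u : Q) : #|orbit 'P <[c]>%G u| = #[c].
  rewrite card_orbit (_ : 'C_<[c]>[u | 'P] = 1%G) ?indexg1 //.
  apply/eqP; rewrite eqEsubset sub1G andbT; apply/subsetP=> g.
  case/setIP=> /cycleP [k ->] /astab1P; rewrite /= /aperm => E.
  by rewrite inE (free _ _ E).
have := acts_sum_card_orbit (G := <[c]>%G) (S := [set: Q]) (to := 'P%act).
rewrite cardsT => <-; last by apply/actsP=> ? ? ?; rewrite !in_setT.
by apply: dvdn_sum => X /imsetP [u _ ->]; rewrite tr.
Qed.

Record involutory_latin_quandle (Q : finType) (s : Q -> {perm Q}) : Prop := {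
  quandle_fix : forall x, s x x = x;
  quandle_inv : forall x, s x * s x = 1;
  quandle_aut : forall x y, s (s x y) = s x * s y * s x;
  quandle_latin : forall y, injective (fun x => s x y)
}.

Section Quandle.

Variables (p n : nat) (Q : finType) (e : Q) (s : Q -> {perm Q}).
Hypotheses (p_prime : prime p) (p_gt2 : 2 < p) (cardQ : #|Q| = (p ^ n)%N).
Hypothesis sQ : involutory_latin_quandle s.

Let s_fix := quandle_fix sQ.
Let s_inv := quandle_inv sQ.
Let s_aut := quandle_aut sQ.
Let s_latin := @quandle_latin _ _ sQ.
Let J := s e.
Definition displ x := s e * s x.
Definition refl_group : {group {perm Q}} := <<[set s x | x : Q]>>%G.
Definition displ_group : {group {perm Q}} := <<[set displ x | x : Q]>>%G.

Lemma sV x : (s x)^-1 = s x.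
Proof. by apply/eqP; rewrite eq_invg_mul s_inv. Qed.

Lemma s_inj : injective s.
Proof. by move=> x y E; apply: (@s_latin e); rewrite /= E. Qed.

Lemma sJs x y : s x ^ s y = s (s y x).
Proof. by rewrite s_aut conjgE sV mulgA. Qed.

Lemma s_in x : s x \in refl_group.
Proof. by apply: mem_gen; apply: imset_f. Qed.

Lemma sJ g x : g \in refl_group -> s x ^ g = s (g x).
Proof.
move=> gX; have [m [c cs ->]] := gen_prodgP gX.
elim: m c cs x => [|m IH] c cs x; first by rewrite big_ord0 conjg1 perm1.
rewrite big_ord_recl conjgM.
have /imsetP [y _ E] := cs ord0.
by rewrite E sJs permM IH.
Qed.

(** Conjugating [s a] by [s x] and then by [s y] raises the exponent by two and keeps the shape,
    hence the induction with step 2. *)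
Lemma spow x y k : exists a, (s x * s y) ^+ k = s x * s a.
Proof.
elim/ltn_ind: k => -[|[|k]] IH.
- by exists x; rewrite s_inv.
- by exists y.
have [|a Ea] := IH k; first by rewrite ltnS leqW.
exists (s y (s x a)).
by rewrite expgS expgSr Ea !s_aut !mulgA.
Qed.

(** A fixed point gives s_x(z) = s_y(z), and the latin property forces x = y. With [spow] this makes
    every product of two reflections semiregular. *)
Lemma s_free x y z : (s x * s y) z = z -> s x * s y = 1.
Proof.
rewrite permM => E; suff -> : x = y by rewrite s_inv.
by apply: (@s_latin z); rewrite /= -[in RHS]E -permM s_inv perm1.
Qed.

Lemma s_order_dvd x y : #[s x * s y] %| #|Q|.
Proof.
apply: semiregular_order_dvd => k z.
by have [a ->] := spow x y k; apply: s_free.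
Qed.

Lemma s_pelt x y : p.-elt (s x * s y).
Proof. by apply: pnat_dvd (s_order_dvd x y) _; rewrite cardQ pnatX pnat_id. Qed.

Lemma JX : J \in refl_group. Proof. exact: s_in. Qed.

Lemma base_trans y x : exists a, s a y = x.
Proof.
by have [g _ gK] := injF_bij (@s_latin y); exists (g x); apply: gK.
Qed.

Lemma classJ : J ^: refl_group = [set s x | x : Q].
Proof.
apply/setP=> g; apply/imsetP/imsetP => [[h hX ->]|[x _ ->]].
  by exists (h e) => //; rewrite sJ.
have [a <-] := base_trans e x.
by exists (s a); rewrite ?s_in // sJs.
Qed.

Lemma index_cent_J : #|refl_group : 'C_refl_group[J]| = (p ^ n)%N.
Proof. by rewrite index_cent1 classJ card_imset //; exact: s_inj. Qed.

Lemma J_conj g : g \in refl_group -> J ^ g * J = s (g e) * s e.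
Proof. by move=> gX; rewrite sJ. Qed.

Lemma p_odd_order (gT : finGroupType) (x : gT) : p.-elt x -> odd #[x].
Proof. exact: pnat_odd. Qed.

(* If a maximal [J]-invariant p-subgroup [R] were not Sylow, take [t] normalising
   [R], [t] outside [R], in a larger p-group.  By maximality [k = J^t J] is in [R],
   so [J^t = J^r] with [r] in [R], and then [t r^-1], which commutes with [J],
   would be in [R] as well. *)
Lemma J_normal_Sylow : exists2 R : {group {perm Q}}, p.-Sylow(refl_group) R & J \in 'N(R).
Proof.
pose gP (R : {group {perm Q}}) := [&& p.-group R, R \subset refl_group & J \in 'N(R)].
have gP1 : gP 1%G by rewrite /gP pgroup1 sub1G norm1 inE.
have [R /maxgroupP [/and3P [pR sRX JR] maxR] _] := maxgroup_exists gP1.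
exists R => //; have [P sylP sRP] := Sylow_superset sRX pR.
have [RP|neRP] := eqVneq (R : {set _}) P; first by rewrite RP.
have pP := pHall_pgroup sylP; have sPX := pHall_sub sylP.
have ltRP : R \proper P by rewrite properEneq neRP.
have /properP [_ [t tN tR]] := nilpotent_proper_norm (pgroup_nil pP) ltRP.
have{tN} [tP tN] := setIP tN.
(* By maximality, a p-element normalising [R] whose cyclic group is [J]-invariant cannot enlarge
   [R]. *)
have inR c : p.-elt c -> c \in refl_group -> c \in 'N(R) -> J \in 'N(<[c]>) -> c \in R.
  move=> pc cX cN Jc.

  have E : R <*> <[c]> = R :> {set _}.
    apply: maxR; last exact: joing_subl.
    apply/and3P; split.
    - by rewrite /= norm_joinEr ?cycle_subG // pgroupM pR.
    - by rewrite join_subG sRX cycle_subG.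
    - by rewrite -sub1set normsY ?sub1set.
  by rewrite -E mem_gen // inE cycle_id orbT.
have JJ : J * J = 1 := s_inv e; have JV : J^-1 = J := sV e.
have tX := subsetP sPX _ tP.
pose k := J ^ t * J.
have kJ : k ^ J = k^-1.
  by rewrite /k conjgE JV invMg -conjVg JV -!mulgA JJ mulg1.
have cyc_norm (c d : {perm Q}) : c ^ d \in <[c]> -> d \in 'N(<[c]>).
  by move=> ?; rewrite inE -cycleJ cycle_subG.
have kR : k \in R.
  apply: inR.
  - by rewrite /k J_conj //; apply: s_pelt.
  - by rewrite groupM ?groupJ ?JX.
  - by rewrite groupM ?groupJ.
  - by apply: cyc_norm; rewrite kJ groupV cycle_id.
have ok : odd #[k] by apply: p_odd_order; rewrite /k J_conj //; apply: s_pelt.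
(* The square root of [k^-1] in a cyclic group of odd order. Since [J] inverts it, J^r = r^-2 J = k
   J = J^t. *)
pose r := k^-1 ^+ (#[k].+1)./2.
have rR : r \in R by rewrite groupX ?groupV.
have rJ : r ^ J = r^-1 by rewrite /r conjXg conjVg kJ invgK -expVgn invgK.
have r2 : r ^+ 2 = k^-1.
  by rewrite /r -expgM mulnC expgM -orderV odd_expg_half ?orderV.
have Jr : J ^ r = J ^ t.
  have : J ^ t = k * J by rewrite /k -mulgA JJ mulg1.
  move->; rewrite -[k]invgK -r2 expgS expg1 invMg -{2}rJ !conjgE JV !mulgA.
  by rewrite -!mulgA JJ mulg1.
case/negP: tR; rewrite -(groupMr t (groupVr rR)); apply: inR.
- by apply: mem_p_elt pP _; rewrite groupM // groupV (subsetP sRP).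
- by rewrite groupM ?groupV // (subsetP sRX).
- by rewrite groupM // groupV (subsetP (normG R)).
- have cJ : commute J (t * r^-1).
    by apply/commgP/conjg_fixP; rewrite conjgM -Jr -conjgM mulgV conjg1.
  apply: cyc_norm; have -> : (t * r^-1) ^ J = t * r^-1; last exact: cycle_id.
  exact/conjg_fixP/commgP/commute_sym.
Qed.

Lemma displJ x : displ x ^ J = (displ x)^-1.
Proof. by rewrite conjgE /displ invMg !sV !mulgA s_inv mul1g. Qed.

Lemma displ_inj : injective displ.
Proof. by move=> x y /mulgI /s_inj. Qed.

Lemma displ_in x : displ x \in displ_group.
Proof. by apply: mem_gen; apply: imset_f. Qed.

Lemma displ_group_sub : displ_group \subset refl_group.
Proof.
by rewrite gen_subG; apply/subsetP=> _ /imsetP [x _ ->]; rewrite groupM ?s_in.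
Qed.

(** For the [J]-invariant Sylow subgroup [R], the index of [R] is prime to that of C(J), so the
    reflection group is C(J) R. Every reflection is then J^r with [r] in [R], and J J^r = (r^-1)^J r
    lies in [R]. *)
Lemma displ_pgroup : p.-group displ_group.
Proof.
have [R sylR JR] := J_normal_Sylow.
have XE : 'C_refl_group[J] * R = refl_group.
  apply: coprime_index_mulG; first exact: subsetIl.
    exact: pHall_sub sylR.
  rewrite index_cent_J; have /and3P [_ _] := sylR.
  by apply: pnat_coprime; rewrite pnatX pnat_id.
apply: pgroupS (pHall_pgroup sylR).
rewrite gen_subG; apply/subsetP=> _ /imsetP [x _ ->].
have [a ax] := base_trans e x.
have: s a \in refl_group by exact: s_in.
rewrite -{1}XE => /mulsgP [c r /setIP [_ /cent1P cJ] rR sE].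
have -> : displ x = r^-1 ^ J * r.
  rewrite /displ -{1}ax -sJs sE conjgM -/J.
  have -> : J ^ c = J by apply/conjg_fixP/commgP.
  by rewrite !conjgE sV !mulgA.
by rewrite groupM // memJ_norm ?groupV.
Qed.

Lemma displ_transitive x : exists2 g, g \in displ_group & g e = x.
Proof.
have [a ax] := base_trans e x.
by exists (displ a); rewrite ?displ_in // /displ permM s_fix.
Qed.

Lemma J_norm_displ_group : J \in 'N(displ_group).
Proof.
rewrite inE -genJ genS //; apply/subsetP=> _ /imsetP [_ /imsetP [x _ ->] ->].
apply/imsetP; exists (s e x) => //.
by rewrite displJ /displ s_aut invMg !sV !mulgA s_inv mul1g.
Qed.

Lemma displX x k : exists y, displ x ^+ k = displ y.
Proof. by have [y E] := spow e x k; exists y. Qed.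

(** If [J] inverts [g], then [displ (g e)] = J J^g = g^2. As [g] has odd order it is a power of g^2,
    and powers of displacements are displacements. *)
Lemma inverted_displ g : g \in displ_group -> g ^ J = g^-1 -> exists x, g = displ x.
Proof.
move=> gO gJ; have gX := subsetP displ_group_sub _ gO.
have og : odd #[g] by apply: p_odd_order; apply: mem_p_elt displ_pgroup gO.
have JV : J^-1 = J := sV e.
have gVJ : J * g^-1 * J = g by rewrite -gJ conjgE JV !mulgA s_inv mul1g -mulgA s_inv mulg1.
have E : displ (g e) = g ^+ 2.
  by rewrite /displ -sJ // -/J conjgE !mulgA gVJ expgS expg1.
have [y Ey] := displX (g e) (#[g].+1)./2.
by exists y; rewrite -Ey E odd_expg_half.
Qed.

Definition inv_center := [set z in 'Z(displ_group) | z ^ J == z^-1].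

Lemma inv_centerE z : (z \in inv_center) = (z \in 'Z(displ_group)) && (z ^ J == z^-1).
Proof. by rewrite inE. Qed.

Lemma inv_center_group_set : group_set inv_center.
Proof.
apply/group_setP; split; first by rewrite inv_centerE group1 conj1g invg1 eqxx.
move=> x y; rewrite !inv_centerE => /andP [xZ /eqP xJ] /andP [yZ /eqP yJ].
apply/andP; split; first exact: groupM.
have [_ /centP cy] := setIP yZ.
by rewrite conjMg xJ yJ -invMg (cy x) //; have [] := setIP xZ.
Qed.
Definition inv_center_group := Group inv_center_group_set.

Lemma inv_centerP z : reflect
  [/\ z \in displ_group, forall g, g \in displ_group -> commute z g & z ^ J = z^-1]
  (z \in inv_center).
Proof.
apply: (iffP idP) => [|[zO zC zJ]].
  by rewrite inv_centerE => /andP [/setIP [zO /centP zC] /eqP].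
by rewrite inv_centerE zJ eqxx andbT inE zO; apply/centP.
Qed.

(** For central [z], the displacement [displ (z e)] = (z^-1)^J z is central and inverted. If it were
    trivial, [z] would fix [e], and then every point, because it commutes with a transitive
    group. *)
Lemma inv_center_nontrivial : 0 < n -> exists2 z, z \in inv_center & z != 1.
Proof.
move=> n0.
have [x xe] : exists x, x != e.
  apply/existsP; rewrite -[[exists x, _]]negbK negb_exists; apply/negP=> /forallP H.
  have : #|Q| <= 1.
    by apply/fintype_le1P => u v; rewrite (eqP (negPn (H u))) (eqP (negPn (H v))).
  by rewrite cardQ leqNgt -{1}(expn0 p) ltn_exp2l ?prime_gt1 // n0.
have O1 : displ_group :!=: 1.
  apply: contraNneq xe => O1; apply/eqP/displ_inj.
  have := displ_in x; have := displ_in e.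
  by rewrite O1 !inE => /eqP -> /eqP ->.
have : 'Z(displ_group) != 1 by apply: contraNneq O1 => /(trivg_center_pgroup displ_pgroup) ->.
case/trivgPn=> z zZ z1; have [zO /centP zC] := setIP zZ.
have zX := subsetP displ_group_sub _ zO.
pose k := displ (z e).
have kE : k = z^-1 ^ J * z.
  by rewrite /k /displ -sJ // -/J !conjgE sV !mulgA.
have NZ : J \in 'N('Z(displ_group)).
  by rewrite (subsetP (char_norms (center_char _))) ?J_norm_displ_group.
have kZ : k \in 'Z(displ_group) by rewrite kE groupM ?memJ_norm ?groupV.
exists k; first by rewrite inv_centerE kZ /= displJ.
apply: contraNneq z1 => k1; have ze : z e = e.
  by apply: displ_inj; rewrite -/k k1 /displ s_inv.
apply/eqP/permP=> y; rewrite perm1.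
by have [g gO <-] := displ_transitive y; rewrite -permM -zC // permM ze.
Qed.

(* If [|inv_center| p^2 > p^n], then [inv_center] and any further [displ x]
   generate an abelian group of inverted elements which is too big not to
   contain them all. *)
Lemma displ_dichotomy : abelian displ_group \/ (#|inv_center| * p ^ 2 <= p ^ n)%N.
Proof.
have [?|ltZ] := leqP (#|inv_center| * p ^ 2) (p ^ n); [by right | left].
have sKO : [set displ x | x : Q] \subset displ_group.
  by apply/subsetP=> _ /imsetP [x _ ->]; apply: displ_in.
have [sKZ|] := boolP ([set displ x | x : Q] \subset inv_center).
  have sOZ : displ_group \subset inv_center_group by rewrite gen_subG.
  apply: abelianS (center_abelian displ_group); apply: subset_trans sOZ _.
  by apply/subsetP=> z; rewrite inv_centerE => /andP [].
case/subsetPn=> k kK kZ; have [x _ kE] := imsetP kK.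
have kO := subsetP sKO _ kK.
have cZk : inv_center_group \subset 'C(<[k]>).
  by rewrite cent_cycle; apply/subsetP=> z /inv_centerP [_ zC _]; apply/cent1P/zC.
pose H := inv_center_group <*> <[k]>.
have HE : H = inv_center_group * <[k]> by rewrite /H cent_joinEl.
have sHO : H \subset displ_group.
  by rewrite join_subG cycle_subG kO andbT; apply/subsetP=> z /inv_centerP [].
have sHK : H \subset [set displ x | x : Q].
  apply/subsetP=> h hH; have hO := subsetP sHO _ hH; move: hH; rewrite HE.
  case/mulsgP=> z _ /[swap] /cycleP [i ->] /inv_centerP [zO zC zJ] hE.
  have [|y ->] := inverted_displ hO; last exact: imset_f.
  by rewrite hE conjMg zJ conjXg kE displJ -kE invMg expVgn; apply: commuteV;
    apply/commute_sym/commuteV; apply/commute_sym/zC; rewrite groupX.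
have abH : abelian H.
  rewrite /H abelianY cycle_abelian centsC cZk !andbT.
  apply: abelianS (center_abelian displ_group).
  by apply/subsetP=> z; rewrite inv_centerE => /andP [].
have ltZH : inv_center_group \proper H.
  rewrite /proper joing_subl; apply: contra kZ => /subsetP -> //.
  by rewrite mem_gen // inE cycle_id orbT.
have pH : p.-group H := pgroupS sHO displ_pgroup.
have leH : (#|inv_center| * p <= #|H|)%N.
  have sZH := proper_sub ltZH.
  rewrite -(Lagrange sZH) leq_mul2l; apply/orP; right.
  have : p.-nat #|H : inv_center_group| by apply: pnat_dvd (dvdn_indexg _ _) pH.
  case/p_natP => // -[|i ->]; last by rewrite expnS leq_pmulr // expn_gt0 prime_gt0.
  by move=> E; move: ltZH; rewrite properE -(indexg_eq1 [group of H] inv_center_group) E eqxx andbF.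
have cardK : #|[set displ x | x : Q]| = (p ^ n)%N by rewrite card_imset //; apply: displ_inj.
have HK : [set displ x | x : Q] = H.
  (* [H] consists of displacements, of which there are p^n; conversely |H| is a power of p with |H|
     p >= |Z| p^2 > p^n. *)
  apply/esym/eqP; rewrite eqEcard sHK cardK.
  have [i Ei] := p_natP pH.
  rewrite Ei leq_exp2l ?prime_gt1 // -ltnS -(ltn_exp2l _ _ (prime_gt1 p_prime)).
  by apply: leq_trans ltZ _; rewrite -mulnn mulnA expnSr -Ei leq_mul2r leH orbT.
by apply: abelianS abH; rewrite gen_subG HK.
Qed.

Lemma displ_cases : n <= 3 -> abelian displ_group \/
  n = 3 /\ exists x, [/\ #[displ x] = p, displ x != 1 & inv_center = <[displ x]> ].
Proof.
move=> n3; have [?|leZ] := displ_dichotomy; [by left | right].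
have Z0 : 0 < #|inv_center| := cardG_gt0 inv_center_group.
have n2 : 2 <= n.
  by rewrite -(leq_exp2l _ _ (prime_gt1 p_prime)) (leq_trans _ leZ) // leq_pmull.
have [z zZ z1] := inv_center_nontrivial (ltnW n2).
have pZ : p.-group inv_center_group.
  by apply: pgroupS displ_pgroup; apply/subsetP=> u /inv_centerP [].
have [d Ed] := p_natP pZ; rewrite /= in Ed.
have d0 : 0 < d.
  rewrite lt0n; apply: contraNneq z1 => d0.
  have E : inv_center_group :=: 1 by apply: card1_trivg; rewrite /= Ed d0.
  by rewrite -in_set1 -[[set 1]]E.
have led : d + 2 <= n by rewrite -(leq_exp2l _ _ (prime_gt1 p_prime)) expnD -Ed.
have cardZ : #|inv_center| = p by rewrite Ed (_ : d = 1%N) ?expn1 //; lia.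
split; first lia.
have /inv_centerP [zO _ zJ] := zZ; have [x Ex] := inverted_displ zO zJ.
exists x; rewrite -Ex.
have sz : <[z]> \subset inv_center_group by rewrite cycle_subG.
have oz : #[z] = p.
  rewrite -order_eq1 in z1; apply/(prime_nt_dvdP p_prime z1).
  by have := cardSg sz; rewrite /= cardZ.
split=> //; apply/eqP; rewrite eq_sym eqEcard; apply/andP; split=> //.
by rewrite cardZ -oz.
Qed.

End Quandle.

(** * Bruck loops *)

Definition abelian_loop (L : finLoop) :=
  associative (@lmul L) /\ commutative (@lmul L).

Definition central (L : finLoop) (c : L) :=
  [/\ forall x, x ⋅ c = c ⋅ x, forall x y, (c ⋅ x) ⋅ y = c ⋅ (x ⋅ y)
    & forall x y, x ⋅ (c ⋅ y) = c ⋅ (x ⋅ y)].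

Section LoopTheory.

Variable L : finLoop.
Implicit Types x y z c : L.

Lemma ltransE x y : ltrans x y = x ⋅ y. Proof. by rewrite permE. Qed.

Lemma lmulI x : injective (lmul x).
Proof. exact: bij_inj (ltrans_bij x). Qed.

Lemma lmulIr x : injective (fun y => lmul y x).
Proof. exact: bij_inj (rtrans_bij x). Qed.

Lemma ltrans1 : ltrans e = 1 :> {perm L}.
Proof. by apply/permP=> x; rewrite ltransE lmul1l perm1. Qed.

Lemma ltrans_inj : injective (@ltrans L).
Proof. by move=> x y /permP /(_ e); rewrite !ltransE !lmull1. Qed.

Lemma ltrans_comm x y : commute (ltrans x) (ltrans y) <->
  forall z, x ⋅ (y ⋅ z) = y ⋅ (x ⋅ z).
Proof.
split=> [E z|E]; last by apply/permP=> z; rewrite !permM !ltransE.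
by have /permP /(_ z) := E; rewrite !permM !ltransE.
Qed.

Lemma central_abelian : (forall c, central c) -> abelian_loop L.
Proof.
by move=> cL; split=> x y; [move=> z|]; have [cx cxy _] := cL x; rewrite ?cxy ?cx.
Qed.

End LoopTheory.

Section Bruck.

Variables (p n : nat) (L : finLoop).
Hypotheses (p_prime : prime p) (p_gt2 : 2 < p) (cardL : #|L| = (p ^ n)%N).
Hypothesis bruckL : bruck_loop L.
Implicit Types x y z c : L.

Let bol : left_bol L := bruckL.1.
Let aip : automorphic_inverse L := bruckL.2.
Local Notation inv := (@loop_inv L).

Lemma bol_mulVK x z : inv x ⋅ (x ⋅ z) = z.
Proof. by apply: (@lmulI _ x); rewrite bol left_bol_mulV // lmull1. Qed.

Lemma bol_invK : involutive inv.
Proof. by move=> x; apply: (@lmulI _ (inv x)); rewrite loop_mulV left_bol_mulV. Qed.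

Lemma bol_mulKV x z : x ⋅ (inv x ⋅ z) = z.
Proof. by rewrite -{1}(bol_invK x) bol_mulVK. Qed.

Lemma bol_ltransV x : ltrans (inv x) = (ltrans x)^-1.
Proof.
apply/eqP; rewrite eq_sym eq_invg_mul; apply/eqP/permP=> z.
by rewrite permM !ltransE perm1 bol_mulVK.
Qed.

Definition binv : {perm L} := perm (can_inj bol_invK).

Lemma binvE x : binv x = inv x. Proof. by rewrite permE. Qed.

Lemma binv_inv : binv * binv = 1.
Proof. by apply/permP=> x; rewrite permM !binvE perm1 bol_invK. Qed.

Lemma binvV : binv^-1 = binv.
Proof. by apply/eqP; rewrite eq_invg_mul binv_inv. Qed.

Lemma binvJ x : ltrans x ^ binv = (ltrans x)^-1.
Proof.
rewrite -bol_ltransV conjgE binvV; apply/permP=> z.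
by rewrite !permM !ltransE !binvE aip bol_invK.
Qed.

Lemma bol_ltrans x y : ltrans x * ltrans y * ltrans x = ltrans (x ⋅ (y ⋅ x)).
Proof. by apply/permP=> z; rewrite !permM !ltransE bol. Qed.

Lemma bol_ltransX x k : exists y, ltrans x ^+ k = ltrans y.
Proof.
elim/ltn_ind: k => -[|[|k]] IH; [by exists e; rewrite ltrans1 | by exists x |].
have [|y Ey] := IH k; first by rewrite ltnS leqW.
by exists (x ⋅ (y ⋅ x)); rewrite -bol_ltrans -Ey -expgS -expgSr.
Qed.

Lemma ltrans_order_odd x : odd #[ltrans x].
Proof.
apply: (@pnat_odd p) => //; apply: (@pnat_dvd _ (p ^ n)); last by rewrite pnatX pnat_id.
rewrite -cardL; apply: semiregular_order_dvd => k z.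
have [y ->] := bol_ltransX x k; rewrite ltransE -{2}(lmul1l z) => /lmulIr ->.
exact: ltrans1.
Qed.

(** With u = (xy)^-1 and m the right-hand side, the automorphic inverse property collapses u(mu) to
    the identity. The Bol identity for u, m and xy then reads um = xy. *)
Lemma bruck_sqr x y : (x ⋅ y) ⋅ (x ⋅ y) = x ⋅ ((y ⋅ y) ⋅ x).
Proof.
set m := _ ⋅ (_ ⋅ x); pose u := inv (x ⋅ y).
have yy z : (y ⋅ y) ⋅ z = y ⋅ (y ⋅ z) by have := bol y e z; rewrite !lmul1l.
have mE z : m ⋅ z = x ⋅ ((y ⋅ y) ⋅ (x ⋅ z)) by rewrite bol.
have : u ⋅ (m ⋅ u) = e.
  by rewrite mE yy /u aip bol_mulKV loop_mulV lmull1 -aip left_bol_mulV.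
move=> umu; have := bol u m (x ⋅ y); rewrite umu lmul1l left_bol_mulV // lmull1.
by move/(congr1 (lmul (x ⋅ y))); rewrite bol_mulKV.
Qed.

Definition bruck_refl x : {perm L} := binv * (ltrans x * ltrans x).

Lemma bruck_reflE x y : bruck_refl x y = x ⋅ (x ⋅ inv y).
Proof. by rewrite !permM !ltransE binvE. Qed.

Lemma bruck_refl_fix x : bruck_refl x x = x.
Proof. by rewrite bruck_reflE loop_mulV lmull1. Qed.

Lemma bruck_refl_inv x : bruck_refl x * bruck_refl x = 1.
Proof.
have -> : bruck_refl x * bruck_refl x = (ltrans x * ltrans x) ^ binv * (ltrans x * ltrans x).
  by rewrite /bruck_refl conjgE binvV !mulgA.
by rewrite conjMg binvJ -invMg mulVg.
Qed.

(** Since s_x(y) = x^2 y^-1, [bruck_sqr] computes the squared translation of s_x(y) as L_x^2 L_y^-2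
    L_x^2, and [binv] inverts each translation. *)
Lemma bruck_refl_aut x y :
  bruck_refl (bruck_refl x y) = bruck_refl x * bruck_refl y * bruck_refl x.
Proof.
have sq z : ltrans (z ⋅ z) = ltrans z * ltrans z.
  by have := bol_ltrans z e; rewrite lmul1l ltrans1 mulg1.
have -> : bruck_refl x y = (x ⋅ x) ⋅ inv y.
  by rewrite bruck_reflE; have := bol x e (inv y); rewrite !lmul1l.
rewrite {1}/bruck_refl -sq bruck_sqr -bol_ltrans !sq bol_ltransV.
rewrite /bruck_refl; set a := ltrans x; set b := ltrans y.
have -> : binv * (a * a) * (binv * (b * b)) * (binv * (a * a))
    = binv * (a * a * (b * b) ^ binv * (a * a)).
  by rewrite conjgE binvV !mulgA.
by rewrite conjMg binvJ.
Qed.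

Lemma bruck_sqr_inj : injective (fun x => x ⋅ x).
Proof.
have sq z : ltrans (z ⋅ z) = ltrans z ^+ 2.
  by have := bol_ltrans z e; rewrite lmul1l ltrans1 mulg1.
move=> x y /= E; apply: ltrans_inj.
have {}E : ltrans x ^+ 2 = ltrans y ^+ 2 by rewrite -!sq E.
have oxy : #[ltrans x] = #[ltrans y].
  have h z : #[ltrans z ^+ 2] = #[ltrans z].
    by rewrite orderXgcd (eqP (_ : coprime _ 2)) ?divn1 // coprimen2 ltrans_order_odd.
  by rewrite -h E h.
by rewrite -(odd_expg_half (ltrans_order_odd x)) E oxy odd_expg_half ?ltrans_order_odd.
Qed.

Lemma bruck_refl_latin y : injective (fun x => bruck_refl x y).
Proof.
move=> x x' /=; rewrite !bruck_reflE => E; apply: bruck_sqr_inj.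
have := bol x e (inv y); have := bol x' e (inv y).
by rewrite /= !lmul1l -E => -> /lmulIr.
Qed.

Local Notation O := (displ_group e bruck_refl).

Lemma bruck_displ x : displ e bruck_refl x = ltrans x ^+ 2.
Proof.
by rewrite /displ /bruck_refl ltrans1 !mulg1 mulgA binv_inv mul1g.
Qed.

Lemma ltrans_displ_group x : ltrans x \in O.
Proof.
by rewrite -(odd_expg_half (ltrans_order_odd x)) groupX // -bruck_displ displ_in.
Qed.

Lemma bruck_displ_ltrans x : exists y, displ e bruck_refl x = ltrans y.
Proof. by have [y Ey] := bol_ltransX x 2; exists y; rewrite bruck_displ. Qed.

(** The missing identity (cx)y = c(xy) needs a square root [r] of [c]: L_x L_c = L_r L_x L_r is
    again a translation by the Bol identity, and evaluation at [e] identifies it. *)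
Lemma bruck_central c : (forall x, commute (ltrans c) (ltrans x)) -> central c.
Proof.
move=> cC; have cxy x y : x ⋅ (c ⋅ y) = c ⋅ (x ⋅ y).
  by rewrite (iffLR (ltrans_comm c x)).
have cx x : x ⋅ c = c ⋅ x by have := cxy x e; rewrite !lmull1.
suff E x : ltrans (c ⋅ x) = ltrans x * ltrans c.
  by split=> // x y; have /permP /(_ y) := E x; rewrite permM !ltransE.
have [r Er] := bol_ltransX c (#[ltrans c].+1)./2.
have r2 : ltrans r ^+ 2 = ltrans c.
  by rewrite -Er -expgM mulnC expgM odd_expg_half // ltrans_order_odd.
have rC y : commute (ltrans r) (ltrans y).
  by rewrite -Er; apply/commute_sym/commuteX/commute_sym.
have := bol_ltrans r x; rewrite rC -mulgA -[_ * ltrans r]/(ltrans r ^+ 2) r2.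
move=> E; rewrite E; congr ltrans.
have /permP /(_ e) := E; rewrite permM !ltransE !lmull1 => <-.
by rewrite -cx.
Qed.

Lemma bruck_quandle : involutory_latin_quandle bruck_refl.
Proof.
split; [exact: bruck_refl_fix | exact: bruck_refl_inv | exact: bruck_refl_aut |].
exact: bruck_refl_latin.
Qed.

(** Conjugation by [h] permutes the reflections, so [h] preserves x(x y^-1). Fixing [e], it also
    preserves inverses and squares, and every element is a square. *)
Lemma bruck_stab_morph (h : {perm L}) : h \in O -> h e = e -> {morph h : x y / x ⋅ y}.
Proof.
move=> hO he; have hX := subsetP (displ_group_sub e bruck_refl) _ hO.
have hs x y : h (x ⋅ (x ⋅ inv y)) = h x ⋅ (h x ⋅ inv (h y)).
  rewrite -!bruck_reflE -(sJ bruck_quandle x hX).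
  by rewrite permJ.
have hV y : h (inv y) = inv (h y) by have := hs e y; rewrite he !lmul1l.
have inv1 : inv e = e by have := loop_mulV (e : L); rewrite lmul1l.
have h2 x : h (x ⋅ x) = h x ⋅ h x by have := hs x e; rewrite he inv1 !lmull1.
have sqr z y : z ⋅ (z ⋅ y) = (z ⋅ z) ⋅ y by have := bol z e y; rewrite !lmul1l.
move=> a b; have [r _ rK] := injF_bij bruck_sqr_inj.
have := hs (r a) (inv b); rewrite !sqr hV !bol_invK rK -h2 /=.
by have /= -> := rK a.
Qed.

Lemma bruck_center : n <= 3 -> abelian_loop L \/
  n = 3 /\ exists c, [/\ central c & #[ltrans c] = p].
Proof.
move=> n3.
have [abO|[-> [x [ox _ xZ]]]] := displ_cases e p_prime p_gt2 cardL bruck_quandle n3.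
  left; apply: central_abelian => c; apply: bruck_central => x.
  by apply: (centsP abO); apply: ltrans_displ_group.
right; split=> //; have [c Ec] := bruck_displ_ltrans x.
exists c; rewrite -Ec; split=> //; apply: bruck_central => y; rewrite -Ec.
have /inv_centerP [_ zC _] : displ e bruck_refl x \in inv_center e bruck_refl.
  by rewrite xZ cycle_id.
exact/zC/ltrans_displ_group.
Qed.

End Bruck.

(** * Commutative automorphic loops *)

Lemma involution_fixpoint (T : finType) (f : T -> T) :
  odd #|T| -> involutive f -> exists x, f x = x.
Proof.
move=> oT fK; pose g : {perm T} := perm (can_inj fK).
have g2 : g ^+ 2 = 1 by apply/permP=> x; rewrite permM !permE fK.
have pg : 2.-group <[g]>.
  by apply: (@pnat_dvd _ 2) => //; rewrite order_dvdn g2.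
have actT : [acts <[g]>, on [set: T] | 'P] by apply/actsP=> ? ? ?; rewrite !in_setT.
have := pgroup_fix_mod pg actT; rewrite cardsT !modn2 oT.
case: (set_0Vmem 'Fix_([set: T] | 'P)(<[g]>)) => [->|[x]]; first by rewrite cards0.
rewrite inE => /andP [_ /afixP /(_ g (cycle_id g))]; rewrite /= /aperm permE => fx _.
by exists x.
Qed.

Section CommutativeAutomorphic.

Variables (p n : nat) (L : finLoop).
Hypotheses (p_prime : prime p) (p_gt2 : 2 < p) (cardL : #|L| = (p ^ n)%N).
Hypothesis caL : commutative_automorphic_loop L.
Implicit Types x y z c : L.

Let lmulC : commutative (@lmul L) := caL.1.
Local Notation inv := (@loop_inv L).

Lemma ltrans_mlt x : ltrans x \in mlt_group L.
Proof. by apply: mem_gen; rewrite inE imset_f. Qed.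

Lemma mlt_stab_morph (h : {perm L}) :
  h \in mlt_group L -> h e = e -> {morph h : x y / x ⋅ y}.
Proof. by move=> hM he; apply: caL.2; rewrite inE hM; apply/astab1P. Qed.

Lemma mlt_stab_inv (h : {perm L}) x :
  h \in mlt_group L -> h e = e -> h (inv x) = inv (h x).
Proof.
move=> hM he; apply: (@lmulI _ (h x)).
by rewrite -mlt_stab_morph // !loop_mulV.
Qed.

Lemma ca_invK : involutive inv.
Proof. by move=> x; apply: (@lmulI _ (inv x)); rewrite loop_mulV lmulC loop_mulV. Qed.

(* [h] below is an automorphism fixing [x = (yz)^-1], with [h z = u^-1] and
   [u * h y^-1 = x]; hence it fixes [y^-1 z^-1 = x] too. *)
Lemma ca_aip : automorphic_inverse L.
Proof.
move=> y z; pose x := inv (y ⋅ z); pose u := x ⋅ y.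
pose h := ltrans y * ltrans x * (ltrans u)^-1.
have hE w : u ⋅ h w = x ⋅ (y ⋅ w).
  by rewrite -!ltransE -(permM h) /h mulgKV permM.
have hM : h \in mlt_group L by rewrite !groupM ?groupV ?ltrans_mlt.
have he : h e = e by apply: (@lmulI _ u); rewrite hE !lmull1.
have hx : h x = x by apply: (@lmulI _ u); rewrite hE (lmulC y) lmulC.
have hz : h z = inv u.
  by apply: (@lmulI _ u); rewrite hE loop_mulV /x lmulC loop_mulV.
apply: (@perm_inj _ h); rewrite -/x hx mlt_stab_morph // (mlt_stab_inv z) // hz.
by rewrite ca_invK lmulC hE loop_mulV lmull1.
Qed.

Definition cinv : {perm L} := perm (can_inj ca_invK).

Lemma cinvE x : cinv x = inv x. Proof. by rewrite permE. Qed.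

Lemma cinv_inv : cinv * cinv = 1.
Proof. by apply/permP=> x; rewrite permM !cinvE perm1 ca_invK. Qed.

Lemma cinvV : cinv^-1 = cinv.
Proof. by apply/eqP; rewrite eq_invg_mul cinv_inv. Qed.

Lemma ca_inv1 : inv e = e.
Proof. by have := loop_mulV (e : L); rewrite lmul1l. Qed.

Lemma ltransJ_cinv x : ltrans x ^ cinv = ltrans (inv x).
Proof.
rewrite conjgE cinvV; apply/permP=> z.
by rewrite !permM !ltransE !cinvE ca_aip ca_invK.
Qed.

Definition ca_refl x : {perm L} := cinv ^ ltrans x.

Lemma ltransVx x : (ltrans x)^-1 x = e.
Proof. by apply: (@perm_inj _ (ltrans x)); rewrite permKV ltransE lmull1. Qed.

Lemma ltransVe x : (ltrans x)^-1 e = inv x.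
Proof. by []. Qed.

Lemma ca_reflE x y : ca_refl x y = ltrans x (cinv ((ltrans x)^-1 y)).
Proof. by rewrite /ca_refl conjgE !permM. Qed.

Lemma ca_refl1 : ca_refl e = cinv.
Proof. by rewrite /ca_refl ltrans1 conjg1. Qed.

(** Elements of the multiplication group fixing [e] are automorphisms and commute with inversion, so
    the conjugate depends on [g e] only. *)
Lemma cinvJ g : g \in mlt_group L -> cinv ^ g = ca_refl (g e).
Proof.
move=> gM; pose h := g * (ltrans (g e))^-1.
have hM : h \in mlt_group L by rewrite groupM ?groupV ?ltrans_mlt.
have he : h e = e by rewrite permM ltransVx.
have gE : g = h * ltrans (g e) by rewrite mulgKV.
clearbody h; rewrite {1}gE conjgM; congr (_ ^ _).
apply/conjg_fixP/commgP/permP=> x.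
by rewrite !permM !cinvE (mlt_stab_inv _ hM he).
Qed.

Lemma ca_reflJ g x : g \in mlt_group L -> ca_refl x ^ g = ca_refl (g x).
Proof.
move=> gM; rewrite {1}/ca_refl -conjgM cinvJ ?groupM ?ltrans_mlt //.
by rewrite permM ltransE lmull1.
Qed.

Lemma ca_reflJ_cinv x : ca_refl x ^ cinv = ca_refl (inv x).
Proof.
have E : ltrans x * cinv = cinv * ltrans (inv x).
  by rewrite -ltransJ_cinv conjgE cinvV !mulgA cinv_inv mul1g.
by rewrite /ca_refl -conjgM E conjgM [cinv ^ cinv]conjgE mulKg.
Qed.

(** By commutativity x -> x\a is an involution. On a set of odd size it has a fixed point, which is
    a square root of [a]; so squaring is onto, hence injective. *)
Lemma ca_sqr_inj : injective (fun x => x ⋅ x).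
Proof.
pose f x := x ⋅ x.
have fT : f @: [set: L] = [set: L].
  apply/setP=> a; rewrite in_setT; apply/imsetP.
  have [||x Ex] := @involution_fixpoint L (fun x => (ltrans x)^-1 a).
  - by rewrite cardL; apply: (@pnat_odd p) => //; rewrite pnatX pnat_id.
  - move=> x; set y := (ltrans x)^-1 a.
    have xy : x ⋅ y = a by rewrite -ltransE permKV.
    by apply: (@perm_inj _ (ltrans y)); rewrite permKV ltransE lmulC xy.
  by exists x; rewrite ?in_setT // /f -{2}Ex -ltransE permKV.
have /imset_injP fI : #|f @: [set: L]| == #|[set: L]| by rewrite fT.
by move=> x y; apply: fI; rewrite in_setT.
Qed.

Lemma ca_quandle : involutory_latin_quandle ca_refl.
Proof.
have reflV x : (ca_refl x)^-1 = ca_refl x by rewrite /ca_refl -conjVg cinvV.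
split=> [x|x|x y|y x x' /= E].
- by rewrite ca_reflE ltransVx cinvE ca_inv1 ltransE lmull1.
- by rewrite -{1}reflV mulVg.
- have -> : ca_refl x * ca_refl y * ca_refl x = ca_refl y ^ ca_refl x.
    by rewrite conjgE reflV [RHS]mulgA.
  have E : ca_refl x = (ltrans x)^-1 * (cinv * ltrans x) by rewrite -conjgE.
  rewrite [X in _ ^ X]E !conjgM.
  rewrite ca_reflJ ?groupV ?ltrans_mlt // ca_reflJ_cinv ca_reflJ ?ltrans_mlt //.
  by rewrite ca_reflE cinvE.
(* Translating [y] to [e] turns s_w(y) into the square of y\w, so the latin property reduces to
   injectivity of squaring. *)
- have gM : (ltrans y)^-1 \in mlt_group L by rewrite groupV ltrans_mlt.
  have key w : ca_refl ((ltrans y)^-1 w) e = (ltrans y)^-1 (ca_refl w y).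
    by rewrite -(ltransVx y) -ca_reflJ // permJ.
  have sq w : ca_refl w e = w ⋅ w.
    by rewrite ca_reflE ltransVe cinvE ca_invK ltransE.
  have := congr1 (ltrans y)^-1 E; rewrite -!key !sq => /ca_sqr_inj.
  exact: perm_inj.
Qed.

Local Notation O := (displ_group e ca_refl).
Local Notation P := (displ e ca_refl).

Lemma ca_displE x : P x = cinv * ca_refl x.
Proof. by rewrite /displ ca_refl1. Qed.

Lemma ca_displV x : (P x)^-1 = ca_refl x * cinv.
Proof. by rewrite ca_displE invMg cinvV /ca_refl -conjVg cinvV. Qed.

Lemma ca_displJ x y : P y ^ ltrans x = (P x)^-1 * P (x ⋅ y).
Proof.
rewrite ca_displV !ca_displE conjMg ca_reflJ ?ltrans_mlt // ltransE.
by rewrite -[RHS]mulgA (mulgA cinv cinv) cinv_inv mul1g.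
Qed.

(** A crossed-homomorphism rule: [P] becomes multiplicative as soon as the translations centralise
    the displacements. *)
Lemma ca_displM x y : P x * P y ^ ltrans x = P (x ⋅ y).
Proof. by rewrite ca_displJ mulKVg. Qed.

Lemma ca_displC x y : P x * P y ^ ltrans x = P y * P x ^ ltrans y.
Proof. by rewrite !ca_displM lmulC. Qed.

Lemma ca_displ_inv x : P (inv x) = (P x)^-1.
Proof.
rewrite -(displJ e ca_quandle x) ca_refl1 !ca_displE conjMg ca_reflJ_cinv.
by rewrite [cinv ^ cinv]conjgE mulKg.
Qed.

Lemma ltrans_norm_displ_group x : ltrans x \in 'N(O).
Proof.
rewrite inE -genJ gen_subG; apply/subsetP=> _ /imsetP [_ /imsetP [y _ ->] ->].
by rewrite ca_displJ groupM ?groupV ?displ_in.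
Qed.

(** Conjugating by inversion replaces L_x by the translation of x^-1. These differ by the factor
    [P x], which centralises the conjugates of [z]. *)
Lemma ltrans_norm_inv_center x (z : {perm L}) :
  z \in inv_center e ca_refl -> z ^ ltrans x \in inv_center e ca_refl.
Proof.
case/inv_centerP=> zO zC zJ; rewrite ca_refl1 in zJ; apply/inv_centerP; split=> [|g gO|].
- by rewrite memJ_norm ?ltrans_norm_displ_group.
- rewrite -[g](conjgKV (ltrans x)) /commute -!conjMg zC //.
  by rewrite memJ_norm // groupV ltrans_norm_displ_group.
rewrite ca_refl1.
have E : ltrans (inv x) * P x = ltrans x.
  have -> : P x = (ltrans (inv x))^-1 * ltrans x; last by rewrite mulKVg.
  by rewrite ca_displE /ca_refl conjgE -ltransJ_cinv -conjVg conjgE cinvV !mulgA.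
have -> : (z ^ ltrans x) ^ cinv = (z ^ cinv) ^ ltrans (inv x).
  rewrite -ltransJ_cinv -!conjgM [_ ^ cinv]conjgE cinvV.
  by rewrite (mulgA cinv cinv) cinv_inv mul1g.
rewrite zJ conjVg; congr (_^-1); rewrite -[in RHS]E conjgM.
apply/esym/conjg_fixP/commgP.
have zxC g : g \in O -> commute (z ^ ltrans (inv x)) g.
  move=> gO; rewrite -[g](conjgKV (ltrans (inv x))) /commute -!conjMg zC //.
  by rewrite memJ_norm // groupV ltrans_norm_displ_group.
exact/zxC/displ_in.
Qed.

(** When [O] is abelian all its elements are inverted, hence of the form [P x]. The commutator
    [P x, L_y] is symmetric, multiplicative and trivial on the diagonal, so its square is 1 and it
    vanishes in odd order. Then [P] embeds the loop in [O]. *)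
Lemma ca_abelian_case : abelian O -> abelian_loop L.
Proof.
move=> abO; have cO := centsP abO.
have Oinv u : u \in O -> exists x, u = P x.
  move=> uO; suff : u \in inv_center_group e ca_refl.
    by case/inv_centerP=> _ _ /(inverted_displ p_prime p_gt2 cardL ca_quandle uO).
  move: u uO; apply/subsetP; rewrite gen_subG; apply/subsetP=> _ /imsetP [x _ ->].
  apply/inv_centerP; split=> [|g|]; [exact: displ_in | exact/cO/displ_in |].
  exact: displJ ca_quandle x.
have PO x : P x \in O := displ_in e ca_refl x.
have PJO x y : P x ^ ltrans y \in O by rewrite memJ_norm ?ltrans_norm_displ_group.
pose beta x y := [~ P x, ltrans y].
have bO x y : beta x y \in O by rewrite /beta commgEl groupM ?groupV.
have bC x y : beta x y = beta y x.
  rewrite /beta !commgEl.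
  have -> : P x ^ ltrans y = (P y)^-1 * (P x * P y ^ ltrans x).
    by rewrite ca_displC mulKg.
  by rewrite mulgA (cO (P x)^-1 _ (P y)^-1) ?groupV // -mulgA mulKg.
have bM x y z t : P z = P x * P y -> beta z t = beta x t * beta y t.
  move=> E; rewrite /beta E commMgJ; congr (_ * _).
  by apply/conjg_fixP/commgP/cO; [apply: bO | apply: PO].
have b1 x : beta x x = 1.
  have := ca_displM x (inv x); rewrite loop_mulV ca_displ_inv conjVg.
  rewrite {3}/displ (quandle_inv ca_quandle) => /eqP.
  by rewrite -eq_mulgV1 => /eqP E; rewrite /beta commgEl -E mulVg.
have b0 x y : beta x y = 1.
  have [z Ez] := Oinv (P x * P y) (groupM (PO x) (PO y)).
  have := b1 z; rewrite (bM x y z z) // !(bC _ z) !(bM x y z) // !b1 mulg1 mul1g.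
  rewrite (bC y x) => E; apply: odd_sqr1; last by rewrite expgS expg1.
  apply: (@pnat_odd p) => //.
  exact: mem_p_elt (displ_pgroup e p_prime p_gt2 cardL ca_quandle) (bO x y).
have PM x y : P (x ⋅ y) = P x * P y.
  rewrite -ca_displM; congr (_ * _).
  by apply/conjg_fixP/eqP; apply: b0.
split=> // x y z; apply: (@displ_inj _ e _ ca_quandle).
by rewrite !PM mulgA.
Qed.

Lemma ca_central_perm (g : {perm L}) :
  (forall x, commute g (ltrans x)) -> g = ltrans (g e) /\ central (g e).
Proof.
move=> gC; have gE : g = ltrans (g e).
  apply/permP=> y; have /permP /(_ e) := gC y.
  by rewrite !permM !ltransE lmull1 => <-; rewrite lmulC.
split=> //; rewrite gE in gC; set c := g e in gC *.
have cxy x y : x ⋅ (c ⋅ y) = c ⋅ (x ⋅ y) by rewrite (iffLR (ltrans_comm c x)).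
by split=> // x y; rewrite lmulC cxy (lmulC y).
Qed.

(* [P x ^ ltrans y] and [P y ^ ltrans x] differ from [P x] and [P y] by the same
   [b] in [<[P x]>]; if [b <> 1], some power [P y'] of [P y] has
   [b = (P x)^-1], so that [P x ^ ltrans y' = 1]. *)
Lemma ca_central_case x : inv_center e ca_refl = <[P x]> -> prime #[P x] ->
  forall y, commute (P x) (ltrans y).
Proof.
move=> inv_centerE prx y; have PZ : P x \in inv_center e ca_refl by rewrite inv_centerE cycle_id.
have /inv_centerP [_ xC _] := PZ.
apply/commgP; apply: contraT => b1; set b := [~ _, _] in b1.
have bZ : b \in <[P x]>.
  rewrite -inv_centerE /b commgEl; apply: (@groupM _ (inv_center_group e ca_refl)).
    exact: groupVr.
  exact: ltrans_norm_inv_center.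
have gb : <[b]> = <[P x]>.
  have sb : <[b]> \subset <[P x]> by rewrite cycle_subG.
  have ob : #[b] = #[P x].
    by apply/(prime_nt_dvdP prx); [rewrite order_eq1 | apply: cardSg].
  by apply/eqP; rewrite eqEcard sb -![#|<[_]>|]/(#[_]) ob leqnn.
have [i Ei] : exists i, (P x)^-1 = b ^+ i.
  by apply/cycleP; rewrite gb groupV cycle_id.
have [y' Ey'] := displX e ca_quandle y i.
have PyJ : P y ^ ltrans x = P y * b.
  apply: (@mulgI _ (P x)); rewrite ca_displC.
  have -> : P x ^ ltrans y = P x * b by rewrite /b commgEl mulKVg.
  by rewrite mulgA -(xC (P y)) ?displ_in // -mulgA.
have bC : commute (P y) b.
  apply/commute_sym; move: bZ; rewrite -inv_centerE => /inv_centerP [_ bC _].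
  exact/bC/displ_in.
have PyJ' : P y' ^ ltrans x = P y' * (P x)^-1.
  by rewrite -Ey' conjXg PyJ expgMn // -Ei.
have := ca_displC x y'; rewrite PyJ' mulgA (xC (P y')) ?displ_in // mulgK.
rewrite -[LHS]mulg1 => /mulgI /esym/eqP; rewrite conjg_eq1 => /eqP Px1.
by move: prx; rewrite Px1 order1.
Qed.

Lemma ca_center : n <= 3 -> abelian_loop L \/
  n = 3 /\ exists c, [/\ central c & #[ltrans c] = p].
Proof.
move=> n3.
have [abO|[-> [x [ox _ xZ]]]] := displ_cases e p_prime p_gt2 cardL ca_quandle n3.
  by left; apply: ca_abelian_case.
right; split=> //; have prx : prime #[P x] by rewrite ox.
have [gE gC] := ca_central_perm (ca_central_case xZ prx).
by exists (P x e); rewrite -gE.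
Qed.

End CommutativeAutomorphic.

Close Scope group_scope.
Import GRing.Theory.

(** * Central quotients *)

Section AutomorphicCriterion.

Variable L : finLoop.
Hypothesis lmulC : commutative (@lmul L).

(** Multiplicativity of the inner mappings z -> (xy)\(x(yz)), phrased by equations so that it can be
    pushed to quotients and shared with Bruck loops. *)
Definition inner_morph := forall x y z w t u : L,
  x ⋅ (y ⋅ z) = (x ⋅ y) ⋅ t -> x ⋅ (y ⋅ w) = (x ⋅ y) ⋅ u ->
  x ⋅ (y ⋅ (z ⋅ w)) = (x ⋅ y) ⋅ (t ⋅ u).

Lemma automorphic_inner_morph : automorphic_loop L -> inner_morph.
Proof.
move=> aut x y z w t u.
pose h := (ltrans y * ltrans x * (ltrans (x ⋅ y))^-1)%g.
have hE v : (x ⋅ y) ⋅ h v = x ⋅ (y ⋅ v).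
  by rewrite -(ltransE (x ⋅ y)) -(permM h) /h mulgKV permM !ltransE.
have he : h e = e by apply: (@lmulI _ (x ⋅ y)); rewrite hE !lmull1.
have hM := @mlt_stab_morph L (conj lmulC aut) h.
rewrite -!hE => /lmulI <- /lmulI <-; rewrite hM //.
by rewrite !groupM ?groupV ?ltrans_mlt.
Qed.

(** By induction on words in translations, each [g] is z -> g(e) h(z) with [h] multiplicative:
    absorbing one more translation costs one inner mapping. Words need no inverses in a finite
    group, and commutativity makes every letter a left translation. *)
Lemma inner_morph_automorphic : inner_morph -> automorphic_loop L.
Proof.
move=> im g /setIP [gM /astab1P ge]; rewrite /= /aperm in ge.
suff [h hM gE] : exists2 h : L -> L, {morph h : x y / x ⋅ y} & forall z, g z = g e ⋅ h z.
  have {}gE z : g z = h z by rewrite gE ge lmul1l.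
  by move=> x y; rewrite !gE hM.
have {gM ge} [m [c cs ->]] := gen_prodgP gM.
elim: m c cs => [|m IH] c cs.
  by exists id => // z; rewrite big_ord0 !perm1 lmul1l.
rewrite big_ord_recr /=; set f := (\prod_(i < m) _)%g.
have [|h hM fE] := IH (fun i => c (widen_ord (leqnSn m) i)); first by move=> i; apply: cs.
have [x ->] : exists x, c ord_max = ltrans x.
  have := cs ord_max; rewrite inE => /orP [] /imsetP [x _ ->]; exists x => //.
  by apply/permP=> z; rewrite !permE lmulC.
set y := f e in fE; pose th z := ((ltrans (x ⋅ y))^-1)%g (x ⋅ (y ⋅ z)).
have thE z : x ⋅ (y ⋅ z) = (x ⋅ y) ⋅ th z by rewrite -[RHS]ltransE /th permKV.
exists (th \o h) => [z w|z] /=.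
  rewrite hM; apply: (@lmulI _ (x ⋅ y)); rewrite -thE.
  exact: im (thE _) (thE _).
by rewrite !permM !ltransE fE thE.
Qed.

End AutomorphicCriterion.

Section SurjectiveMorphism.

Variables (L M : finLoop) (f : L -> M).
Hypotheses (fM : {morph f : x y / x ⋅ y}) (f_surj : forall y, exists x, f x = y).

Lemma surj_morph1 : f e = e.
Proof. by apply: (@lmulI _ (f e)); rewrite -fM !lmull1. Qed.

Lemma surj_morphV x : f (loop_inv x) = loop_inv (f x).
Proof. by apply: (@lmulI _ (f x)); rewrite -fM !loop_mulV surj_morph1. Qed.

Lemma surj_bruck : bruck_loop L -> bruck_loop M.
Proof.
case=> bol aip; split=> [x y z|x y].
  have [[[x' <-] [y' <-]] [z' <-]] := (f_surj x, f_surj y, f_surj z).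
  by rewrite -!fM bol.
have [[x' <-] [y' <-]] := (f_surj x, f_surj y).
by rewrite -fM -!surj_morphV -fM aip.
Qed.

Lemma surj_ca : commutative_automorphic_loop L -> commutative_automorphic_loop M.
Proof.
case=> lC aut.
have mC : commutative (@lmul M).
  move=> x y; have [[x' <-] [y' <-]] := (f_surj x, f_surj y).
  by rewrite -!fM lC.
split=> //; apply: inner_morph_automorphic => // x y z w t u.
have [[x' <-] [y' <-]] := (f_surj x, f_surj y).
have [[z' <-] [w' <-]] := (f_surj z, f_surj w).
have im := automorphic_inner_morph lC aut.
pose th v := ((ltrans (x' ⋅ y'))^-1)%g (x' ⋅ (y' ⋅ v)).
have thE v : x' ⋅ (y' ⋅ v) = (x' ⋅ y') ⋅ th v by rewrite -[RHS]ltransE /th permKV.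
rewrite -!fM (im _ _ _ _ _ _ (thE z') (thE w')) !thE !fM.
by move=> /lmulI <- /lmulI <-.
Qed.

End SurjectiveMorphism.

(** * The quotient by a central element *)

Section CentralQuotient.

Variables (L : finLoop) (c : L).
Hypothesis cC : central c.

Definition cshift k : L -> L := (ltrans c ^+ k)%g.

Lemma cshiftE k x : cshift k x = iter k (lmul c) x.
Proof.
by rewrite /cshift permX; apply: eq_iter => y; rewrite ltransE.
Qed.

Lemma cshiftD k l x : cshift k (cshift l x) = cshift (k + l) x.
Proof. by rewrite !cshiftE iterD. Qed.

Lemma cshift_mull k x y : cshift k x ⋅ y = cshift k (x ⋅ y).
Proof.
have [_ cl _] := cC; rewrite !cshiftE.
by elim: k => //= k IH; rewrite cl IH.
Qed.

Lemma cshift_mulr k x y : x ⋅ cshift k y = cshift k (x ⋅ y).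
Proof.
have [_ _ cr] := cC; rewrite !cshiftE.
by elim: k => //= k IH; rewrite cr IH.
Qed.

Lemma cshift_inj k : injective (cshift k).
Proof. exact: perm_inj. Qed.

Lemma cshift_free k l x : cshift k x = cshift l x -> k = l %[mod #[ltrans c]%g].
Proof.
rewrite -[x]lmul1l -!cshift_mull => /lmulIr E.
apply/eqP; rewrite -eq_expg_mod_order; apply/eqP/permP=> y.
by rewrite -[LHS]/(cshift k y) -[RHS]/(cshift l y) -[y]lmul1l -!cshift_mull E.
Qed.

Let f := ltrans c.

Lemma cshift_connect x y : reflect (exists k, y = cshift k x) (fconnect f x y).
Proof.
apply: (iffP idP) => [/iter_findex <-|[k ->]].
  by exists (findex f x y); rewrite /cshift permX.
by rewrite /cshift permX fconnect_iter.
Qed.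

Lemma croot_eq x y : reflect (exists k, y = cshift k x) (froot f x == froot f y).
Proof.
rewrite (root_connect (fconnect_sym (@perm_inj _ f))).
exact: cshift_connect.
Qed.

(* The quotient is carried by the canonical representatives of the orbits of
   multiplication by [c]. *)
Definition cquot := {x : L | froot f x == x}.

Lemma crootP x : froot f (froot f x) == froot f x.
Proof. by rewrite (root_root (fconnect_sym (@perm_inj _ f))). Qed.

Definition cproj x : cquot := exist _ (froot f x) (crootP x).

Lemma cproj_eq x y : (exists k, y = cshift k x) <-> cproj x = cproj y.
Proof.
split=> [/croot_eq /eqP E|/(congr1 val) /= E]; first exact: val_inj.
by apply/croot_eq/eqP.
Qed.

Lemma cprojK (u : cquot) : cproj (val u) = u.
Proof. by apply: val_inj; apply/eqP; case: u. Qed.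

Definition cmul (u v : cquot) : cquot := cproj (val u ⋅ val v).

Lemma cprojM x y : cproj (x ⋅ y) = cmul (cproj x) (cproj y).
Proof.
have rt z : exists k, val (cproj z) = cshift k z.
  by apply/cproj_eq; rewrite cprojK.
apply/cproj_eq; have [[k ->] [l ->]] := (rt x, rt y).
by exists (k + l)%N; rewrite cshift_mull cshift_mulr cshiftD.
Qed.

Lemma cmul1 : left_id (cproj e) cmul.
Proof. by move=> u; rewrite -[u]cprojK -cprojM lmul1l. Qed.

Lemma cmulr1 : right_id (cproj e) cmul.
Proof. by move=> u; rewrite -[u]cprojK -cprojM lmull1. Qed.

Lemma cmul_lbij u : bijective (fun v => cmul u v).
Proof.
apply: injF_bij => v w /cproj_eq [k]; rewrite -cshift_mulr => /lmulI E.
by rewrite -[v]cprojK -[w]cprojK; apply/cproj_eq; exists k.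
Qed.

Lemma cmul_rbij u : bijective (fun v => cmul v u).
Proof.
apply: injF_bij => v w /cproj_eq [k]; rewrite -cshift_mull => /lmulIr E.
by rewrite -[v]cprojK -[w]cprojK; apply/cproj_eq; exists k.
Qed.

Definition central_quotient : finLoop :=
  FinLoop cmul1 cmulr1 cmul_lbij cmul_rbij.

Lemma cproj_surj (u : central_quotient) : exists x, cproj x = u.
Proof. by exists (val u); apply: cprojK. Qed.

Lemma card_central_quotient : #|L| = (#|central_quotient| * #[ltrans c]%g)%N.
Proof.
pose g (w : cquot * 'I_(#[ltrans c]%g)) := cshift w.2 (val w.1).
have g_inj : injective g.
  move=> [u i] [v j]; rewrite /g /= => E.
  have uv : u = v.
    rewrite -[u]cprojK -[v]cprojK.
    transitivity (cproj (cshift i (val u))); first by apply/cproj_eq; exists i.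
    by rewrite E; apply/esym/cproj_eq; exists j.
  subst v; congr pair; apply/val_inj; have := cshift_free E.
  by rewrite !modn_small.
have g_surj x : exists w, g w = x.
  have [k xE] : exists k, x = cshift k (val (cproj x)) by apply/cproj_eq; rewrite cprojK.
  have lt : (k %% #[ltrans c]%g < #[ltrans c]%g)%N by rewrite ltn_mod order_gt0.
  exists (cproj x, Ordinal lt); rewrite /g [RHS]xE /cshift /=.
  by rewrite expg_mod_order.
have -> : #|L| = #|{: cquot * 'I_(#[ltrans c]%g)}|.
  rewrite -(card_codom g_inj); apply: eq_card => x.
  by have [w <-] := g_surj x; rewrite codom_f.
by rewrite card_prod card_ord.
Qed.

End CentralQuotient.

(** * Associators modulo a central subloop *)

(** Translations lie in the displacement group, so these inner mappings lie in its stabiliser of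
    [e]. *)
Lemma bruck_inner_morph p n (L : finLoop) : prime p -> 2 < p -> #|L| = (p ^ n)%N ->
  bruck_loop L -> inner_morph L.
Proof.
move=> pr p2 cardL bL x y z w t u.
pose h := (ltrans y * ltrans x * (ltrans (x ⋅ y))^-1)%g.
have hE v : (x ⋅ y) ⋅ h v = x ⋅ (y ⋅ v).
  by rewrite -(ltransE (x ⋅ y)) -(permM h) /h mulgKV permM !ltransE.
have he : h e = e by apply: (@lmulI _ (x ⋅ y)); rewrite hE !lmull1.
rewrite -!hE => /lmulI <- /lmulI <-; rewrite (bruck_stab_morph pr p2 cardL) //.
by rewrite !groupM ?groupV ?(ltrans_displ_group pr p2 cardL).
Qed.

(** The dichotomy [cenP] is used twice: on [L], and on its quotient of order p^2, where the
    nonabelian alternative is excluded because it requires n = 3. *)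
Lemma inner_morph_class2 p (L : finLoop) (P : finLoop -> Prop) :
  prime p -> 2 < p -> #|L| = (p ^ 3)%N -> P L ->
  (forall (M : finLoop) (f : L -> M), {morph f : x y / x ⋅ y} ->
     (forall y, exists x, f x = y) -> P M) ->
  (forall n (M : finLoop), #|M| = (p ^ n)%N -> P M -> n <= 3 ->
     abelian_loop M \/ n = 3 /\ exists c : M, [/\ central c & #[ltrans c]%g = p]) ->
  abelian_loop L \/ exists2 c : L, #[ltrans c]%g = p &
    exists cC : central c, abelian_loop (central_quotient cC).
Proof.
move=> pr p2 cardL PL quoP cenP.
have [|[_ [c [cC oc]]]] := cenP 3 L cardL PL (leqnn 3); [by left | right].
exists c => //; exists cC.
have cardM : #|central_quotient cC| = (p ^ 2)%N.
  apply/eqP; rewrite -(eqn_pmul2r (prime_gt0 pr)) -expnSr -cardL.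
  by rewrite (card_central_quotient cC) oc.
have PM : P (central_quotient cC).
  exact: (quoP (central_quotient cC) (@cproj L c) (cprojM cC) (@cproj_surj L c cC)).
by case: (cenP 2 _ cardM PM) => // -[].
Qed.

Local Open Scope ring_scope.

Lemma Fp_nat_neq0 p n : prime p -> (0 < n < p)%N -> n%:R != 0 :> 'F_p.
Proof.
move=> pr /andP [n0 np]; apply/eqP => /(congr1 val) /=.
by rewrite (val_Fp_nat pr) modn_small // => E; rewrite E in n0.
Qed.

Lemma Fp_double_eq0 p (a : 'F_p) : prime p -> (2 < p)%N -> a + a = 0 -> a = 0.
Proof.
move=> pr p2; rewrite -mulr2n -mulr_natl => /eqP.
by rewrite mulf_eq0 (negPf (Fp_nat_neq0 pr _)) // => /eqP.
Qed.

Section ClassTwo.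

Variables (p : nat) (L : finLoop) (c : L) (cC : central c).
Hypotheses (p_prime : prime p) (p_gt2 : (2 < p)%N) (oc : #[ltrans c]%g = p).
Hypothesis abQ : abelian_loop (central_quotient cC).
Implicit Types (x y z w : L) (a b : 'F_p).

Definition fshift a x := cshift c a x.

Lemma fshift_nat k x : cshift c k x = fshift k%:R x.
Proof.
rewrite /fshift /cshift /= val_Fp_nat //; congr (_ x).
by rewrite -(expg_mod_order _ k) oc.
Qed.

Lemma fshiftD a b x : fshift a (fshift b x) = fshift (a + b) x.
Proof. by rewrite {1 2}/fshift cshiftD fshift_nat natrD !natr_Zp. Qed.

Lemma fshift0 x : fshift 0 x = x. Proof. by rewrite /fshift cshiftE. Qed.

Lemma fshiftK a x : fshift (- a) (fshift a x) = x.
Proof. by rewrite fshiftD addNr fshift0. Qed.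

Lemma fshift_inj a : injective (fshift a). Proof. exact: cshift_inj. Qed.

Lemma fshift_free x a b : fshift a x = fshift b x -> a = b.
Proof.
move/(cshift_free cC); rewrite oc => E; rewrite -[a]natr_Zp -[b]natr_Zp; apply/ord_inj.
by rewrite !val_Fp_nat.
Qed.

Lemma fshift_mull a x y : fshift a x ⋅ y = fshift a (x ⋅ y).
Proof. exact: cshift_mull. Qed.

Lemma fshift_mulr a x y : x ⋅ fshift a y = fshift a (x ⋅ y).
Proof. exact: cshift_mulr. Qed.

Lemma cproj_fshift x y : (exists a, y = fshift a x) <-> cproj c x = cproj c y.
Proof.
split=> [[a ->]|/cproj_eq [k ->]]; first by apply/cproj_eq; exists a.
by exists k%:R; rewrite fshift_nat.
Qed.

Lemma cprojA x y z : cproj c ((x ⋅ y) ⋅ z) = cproj c (x ⋅ (y ⋅ z)).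
Proof. by rewrite !(cprojM cC); have [/= -> _] := abQ. Qed.

Lemma cprojC x y : cproj c (x ⋅ y) = cproj c (y ⋅ x).
Proof. by rewrite !(cprojM cC); have [_ /= ->] := abQ. Qed.

(** The exponent of [c] in the associator. The default is never taken, since the quotient is
    associative ([alphaP]). *)
Definition alpha x y z : 'F_p :=
  odflt 0 [pick a | x ⋅ (y ⋅ z) == fshift a ((x ⋅ y) ⋅ z)].

Lemma alphaP x y z : x ⋅ (y ⋅ z) = fshift (alpha x y z) ((x ⋅ y) ⋅ z).
Proof.
have [a Ea] := iffRL (cproj_fshift _ _) (cprojA x y z).
by rewrite /alpha; case: pickP => [b /eqP //|/(_ a)]; rewrite Ea eqxx.
Qed.

Lemma alpha_eq x y z a : x ⋅ (y ⋅ z) = fshift a ((x ⋅ y) ⋅ z) -> alpha x y z = a.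
Proof. by rewrite alphaP; apply: fshift_free. Qed.

Definition kappa x y : 'F_p := odflt 0 [pick a | x ⋅ y == fshift a (y ⋅ x)].

Lemma kappaP x y : x ⋅ y = fshift (kappa x y) (y ⋅ x).
Proof.
have [a Ea] := iffRL (cproj_fshift _ _) (cprojC y x).
by rewrite /kappa; case: pickP => [b /eqP //|/(_ a)]; rewrite Ea eqxx.
Qed.

Lemma kappa_eq x y a : x ⋅ y = fshift a (y ⋅ x) -> kappa x y = a.
Proof. by rewrite kappaP; apply: fshift_free. Qed.

Lemma kappaC x y : kappa y x = - kappa x y.
Proof. by apply: kappa_eq; rewrite [x ⋅ y]kappaP fshiftK. Qed.

Lemma alpha_proj x x' y y' z z' : cproj c x = cproj c x' ->
  cproj c y = cproj c y' -> cproj c z = cproj c z' -> alpha x y z = alpha x' y' z'.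
Proof.
move=> /cproj_fshift [a ->] /cproj_fshift [b ->] /cproj_fshift [a' ->].
apply/esym/alpha_eq; rewrite !(fshift_mull, fshift_mulr) alphaP.
by rewrite !fshiftD; congr fshift; ring.
Qed.

Lemma alpha_pentagon x y z w :
  alpha (x ⋅ y) z w + alpha x y (z ⋅ w)
    = alpha y z w + alpha x (y ⋅ z) w + alpha x y z.
Proof.
apply: (@fshift_free (((x ⋅ y) ⋅ z) ⋅ w)).
transitivity (x ⋅ (y ⋅ (z ⋅ w))).
  by rewrite addrC -[LHS]fshiftD -(alphaP (x ⋅ y)) -(alphaP x).
rewrite (alphaP y z w) fshift_mulr (alphaP x (y ⋅ z) w) (alphaP x y z) fshift_mull.
by rewrite !fshiftD.
Qed.

Lemma alpha_comm x y z :
  (x ⋅ y) ⋅ z = fshift (kappa y z + alpha x z y - alpha x y z) ((x ⋅ z) ⋅ y).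
Proof.
apply: (@fshift_inj (alpha x y z)); rewrite -alphaP (kappaP y z) fshift_mulr.
by rewrite (alphaP x z y) !fshiftD; congr fshift; ring.
Qed.

(** The six left-normed products of x, y, z form a hexagon, linked by [alpha_comm] and by swapping
    the first two factors. Going round it, the commutator terms [kappa] cancel. *)
Lemma alpha_alternating_sum x y z :
  alpha x y z + alpha y z x + alpha z x y = alpha x z y + alpha z y x + alpha y x z.
Proof.
have := alpha_comm x y z.
rewrite (kappaP x y) fshift_mull (alpha_comm y x z) (kappaP y z) fshift_mull.
rewrite (alpha_comm z y x) (kappaP z x) fshift_mull !fshiftD => /fshift_free.
rewrite (kappaC x z) (kappaC x y) => /eqP; rewrite -subr_eq0 => /eqP E.
by apply/eqP; rewrite -subr_eq0 -E; apply/eqP; ring.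
Qed.

Hypothesis imL : inner_morph L.

Lemma alphaDr x y z w : alpha x y (z ⋅ w) = alpha x y z + alpha x y w.
Proof.
apply: alpha_eq.
have h v : x ⋅ (y ⋅ v) = (x ⋅ y) ⋅ fshift (alpha x y v) v.
  by rewrite fshift_mulr -alphaP.
by rewrite (imL (h z) (h w)) !(fshift_mull, fshift_mulr) fshiftD.
Qed.

Section CommutativeCase.

Hypothesis lmulC : commutative (@lmul L).

(** By commutativity x(yz) = (zy)x and (xy)z = z(yx): the same comparison read backwards. *)
Lemma ca_alphaC x y z : alpha z y x = - alpha x y z.
Proof.
apply: alpha_eq; apply: (@fshift_inj (alpha x y z)); rewrite fshiftD subrr fshift0.
by rewrite -(lmulC (y ⋅ x)) -(lmulC x y) -alphaP lmulC (lmulC z).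
Qed.

Lemma ca_alpha_cyclic x y z : alpha x y z + alpha y z x + alpha z x y = 0.
Proof.
apply: (@Fp_double_eq0 p) => //; rewrite {2}alpha_alternating_sum.
by rewrite (ca_alphaC y z x) (ca_alphaC x y z) (ca_alphaC z x y); ring.
Qed.

Lemma ca_alphaDl x x' y z : alpha (x ⋅ x') y z = alpha x y z + alpha x' y z.
Proof. by rewrite !(ca_alphaC z y) alphaDr opprD. Qed.

Lemma ca_alphaDm x y y' z : alpha x (y ⋅ y') z = alpha x y z + alpha x y' z.
Proof.
have E u : alpha x u z = - (alpha u z x + alpha z x u).
  by apply/eqP; rewrite -subr_eq0 opprK addrA ca_alpha_cyclic.
by rewrite !E ca_alphaDl alphaDr; ring.
Qed.

End CommutativeCase.

Section BruckCase.

Hypothesis bol : left_bol L.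
Hypothesis sqr_surj : forall x, exists r, r ⋅ r = x.

Lemma alpha_swapl x y z w : alpha (x ⋅ y) z w = alpha (y ⋅ x) z w.
Proof. exact: alpha_proj (cprojC x y) _ _. Qed.

Lemma alpha_swapm x y z w : alpha w (x ⋅ y) z = alpha w (y ⋅ x) z.
Proof. exact: alpha_proj _ (cprojC x y) _. Qed.

Lemma bol_alpha x y z : alpha x (x ⋅ y) z = - alpha y x z.
Proof.
apply/eqP; rewrite -subr_eq0 opprK; apply/eqP.
apply: (@fshift_free ((x ⋅ (y ⋅ x)) ⋅ z)); rewrite fshift0 -[RHS]bol.
by rewrite (alphaP y x z) fshift_mulr (alphaP x (y ⋅ x)) fshiftD addrC (alpha_swapm x).
Qed.

(** Additivity in the last argument lets [alpha x y z] cancel from the pentagon, leaving a 2-cocycle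
    for each fixed [w]. *)
Lemma bruck_alpha_cocycle x y z w :
  alpha (x ⋅ y) z w + alpha x y w = alpha y z w + alpha x (y ⋅ z) w.
Proof.
have := alpha_pentagon x y z w; rewrite alphaDr.
by rewrite addrCA [RHS]addrC => /addrI.
Qed.

Lemma alpha1l y z : alpha e y z = 0.
Proof. by apply: alpha_eq; rewrite fshift0 !lmul1l. Qed.

Lemma bruck_alpha_alt x z : alpha x x z = 0.
Proof. by have := bol_alpha x e z; rewrite lmull1 alpha1l oppr0. Qed.

(* The commutator [b] of the 2-cocycle [alpha ^~ ^~ z] is bilinear, and the Bol
   identity turns it into [alpha (x ⋅ x) y z]. *)
Let b x y z := alpha x y z - alpha y x z.

Lemma alpha_sqr x y z : alpha (x ⋅ x) y z = b x y z.
Proof.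
have := bruck_alpha_cocycle x x y z.
by rewrite bruck_alpha_alt addr0 bol_alpha.
Qed.

Lemma bruck_b_Dl x x' y z : b (x ⋅ x') y z = b x y z + b x' y z.
Proof.
have h1 := bruck_alpha_cocycle x x' y z.
have h2 := bruck_alpha_cocycle y x x' z.
have h3 := bruck_alpha_cocycle x y x' z.
rewrite (alpha_swapm x' y) in h1; rewrite (alpha_swapl y x) in h2.
rewrite /b -[alpha (x ⋅ x') y z](addrK (alpha x x' z)) h1.
have -> : alpha y (x ⋅ x') z = alpha (x ⋅ y) x' z + alpha y x z - alpha x x' z.
  by rewrite h2 addrC addKr.
have -> : alpha x (y ⋅ x') z = alpha (x ⋅ y) x' z + alpha x y z - alpha y x' z.
  by rewrite h3 addrC addKr.
ring.
Qed.

Lemma bruck_alphaDl x x' y z : alpha (x ⋅ x') y z = alpha x y z + alpha x' y z.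
Proof.
have [[r <-] [r' <-]] := (sqr_surj x, sqr_surj x').
have -> : alpha ((r ⋅ r) ⋅ (r' ⋅ r')) y z = alpha ((r ⋅ r') ⋅ (r ⋅ r')) y z.
  apply: alpha_proj => //; rewrite !(cprojM cC).
  have [/= cA cC'] := abQ.
  by rewrite -!cA; congr cmul; rewrite !cA; congr cmul; apply: cC'.
by rewrite !alpha_sqr bruck_b_Dl.
Qed.

(** For x = r^2, b(x,y) = 2 b(r,y) = 2 alpha(x,y) by additivity and [alpha_sqr], while b(x,y) =
    alpha(x,y) - alpha(y,x) by definition. *)
Lemma bruck_alphaC x y z : alpha y x z = - alpha x y z.
Proof.
have [r <-] := sqr_surj x; have := bruck_b_Dl r r y z.
by rewrite -[b r y z]alpha_sqr {1}/b => /addrI <-; rewrite opprK.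
Qed.

Lemma bruck_alphaDm x y y' z : alpha x (y ⋅ y') z = alpha x y z + alpha x y' z.
Proof. by rewrite !(bruck_alphaC _ x) bruck_alphaDl opprD. Qed.

Lemma bruck_jacobi x y z : alpha x y z + alpha y z x + alpha z x y = 0.
Proof.
apply: (@Fp_double_eq0 p) => //; rewrite {2}alpha_alternating_sum.
by rewrite (bruck_alphaC z x) (bruck_alphaC y z) (bruck_alphaC x y); ring.
Qed.

End BruckCase.

End ClassTwo.

(** * Twisted abelian groups *)

(** Abelian groups are included, with [td_iota] and [td_tau] both zero; injectivity of [td_iota] is
    demanded separately where [td_tau] is nonzero. *)
Record twist_data (p : nat) := TwistData {
  td_sort :> finZmodType;
  td_iota : 'F_p -> td_sort;
  td_tau : td_sort -> td_sort -> td_sort -> 'F_p;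
  td_iotaD : {morph td_iota : a b / a + b};
  td_tauDl : forall x x' y z, td_tau (x + x') y z = td_tau x y z + td_tau x' y z;
  td_tauDm : forall x y y' z, td_tau x (y + y') z = td_tau x y z + td_tau x y' z;
  td_tauDr : forall x y z z', td_tau x y (z + z') = td_tau x y z + td_tau x y z';
  td_alt : forall x z, td_tau x x z = 0;
  td_tau_iotal : forall a y z, td_tau (td_iota a) y z = 0;
  td_tau_iotar : forall a x y, td_tau x y (td_iota a) = 0
}.
Arguments td_iota {p t}.
Arguments td_tau {p t}.

Lemma morphD0 (U V : zmodType) (f : U -> V) : {morph f : x y / x + y} -> f 0 = 0.
Proof. by move=> fD; apply: (@addrI _ (f 0)); rewrite -fD !addr0. Qed.

Lemma morphDN (U V : zmodType) (f : U -> V) x : {morph f : x y / x + y} -> f (- x) = - f x.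
Proof.
move=> fD; apply/eqP; rewrite -subr_eq0 opprK -fD addNr; exact/eqP/morphD0.
Qed.

Section TwistedLoop.

Variables (p : nat) (d : twist_data p) (s t : 'F_p).
Implicit Types x y z : d.

Local Notation iota := (@td_iota p d).
Local Notation tau := (@td_tau p d).

Lemma td_iota0 : iota 0 = 0. Proof. exact: morphD0 (@td_iotaD p d). Qed.

Lemma td_iotaN a : iota (- a) = - iota a.
Proof. exact: morphDN (@td_iotaD p d). Qed.

Lemma td_tau0l y z : tau 0 y z = 0.
Proof. by apply: (morphD0 (f := fun x => tau x y z)) => x x'; apply: td_tauDl. Qed.

Lemma td_tau0m x z : tau x 0 z = 0.
Proof. by apply: (morphD0 (f := fun y => tau x y z)) => y y'; apply: td_tauDm. Qed.

Lemma td_tauNl x y z : tau (- x) y z = - tau x y z.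
Proof. by apply: (morphDN (f := fun x => tau x y z)) => u u'; apply: td_tauDl. Qed.

Lemma td_tauNm x y z : tau x (- y) z = - tau x y z.
Proof. by apply: (morphDN (f := fun y => tau x y z)) => u u'; apply: td_tauDm. Qed.

Lemma td_tauNr x y z : tau x y (- z) = - tau x y z.
Proof. by apply: morphDN => u u'; apply: td_tauDr. Qed.

Lemma td_tauC x y z : tau y x z = - tau x y z.
Proof.
apply/eqP; rewrite -subr_eq0 opprK; apply/eqP.
have := td_alt (x + y) z; rewrite td_tauDl !td_tauDm !td_alt add0r addr0.
by rewrite addrC.
Qed.

Lemma td_tau_iotam a x z : tau x (iota a) z = 0.
Proof. by rewrite td_tauC td_tau_iotal oppr0. Qed.

Definition tw_cocycle x y := s * tau x y x + t * tau x y y.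

Lemma tw_cocycle_iotal x y a : tw_cocycle (x + iota a) y = tw_cocycle x y.
Proof. by rewrite /tw_cocycle !td_tauDl !td_tauDr td_tau_iotar !td_tau_iotal !addr0. Qed.

Lemma tw_cocycle_iotar x y a : tw_cocycle x (y + iota a) = tw_cocycle x y.
Proof.
by rewrite /tw_cocycle !td_tauDm !td_tauDr td_tau_iotar !td_tau_iotam !addr0.
Qed.

Definition tw_mul x y := x + y + iota (tw_cocycle x y).

Lemma tw_mul1l : left_id 0 tw_mul.
Proof.
move=> x; rewrite /tw_mul add0r /tw_cocycle !td_tau0l !mulr0 addr0.
by rewrite td_iota0 addr0.
Qed.

Lemma tw_mull1 : right_id 0 tw_mul.
Proof.
move=> x; rewrite /tw_mul addr0 /tw_cocycle !td_tau0m !mulr0 addr0.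
by rewrite td_iota0 addr0.
Qed.

Lemma iota_cancel x y a b : x + iota a = y + iota b -> y = x + iota (a - b).
Proof.
by move=> E; rewrite td_iotaD td_iotaN addrA E addrK.
Qed.

Lemma tw_ltrans_bij x : bijective (fun y => tw_mul x y).
Proof.
apply: injF_bij => y z; rewrite /tw_mul -!addrA => /addrI E.
have cE : tw_cocycle x z = tw_cocycle x y by rewrite (iota_cancel E) tw_cocycle_iotar.
by move: E; rewrite cE => /addIr.
Qed.

Lemma tw_rtrans_bij x : bijective (fun y => tw_mul y x).
Proof.
apply: injF_bij => y z; rewrite /tw_mul !(addrC _ x) -!addrA => /addrI E.
have cE : tw_cocycle z x = tw_cocycle y x by rewrite (iota_cancel E) tw_cocycle_iotal.
by move: E; rewrite cE => /addIr.
Qed.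

Definition twloop : finLoop := FinLoop tw_mul1l tw_mull1 tw_ltrans_bij tw_rtrans_bij.

Definition tw_assoc x y z :=
  t * tau x y z + (t - s) * tau x z y - s * tau y z x.

Lemma tw_assocP x y z :
  tw_mul x (tw_mul y z) = tw_mul (tw_mul x y) z + iota (tw_assoc x y z).
Proof.
rewrite /tw_mul tw_cocycle_iotar tw_cocycle_iotal (addrAC _ (iota _) z) !addrA.
rewrite -!(addrA (x + y + z)) -!td_iotaD; congr (_ + iota _).
rewrite /tw_cocycle /tw_assoc !(td_tauDl, td_tauDm, td_tauDr).
ring.
Qed.

Lemma tw_mul_iotar x y a : tw_mul x (y + iota a) = tw_mul x y + iota a.
Proof. by rewrite /tw_mul tw_cocycle_iotar addrA [LHS]addrAC. Qed.

Lemma tw_mul_iotal x y a : tw_mul (x + iota a) y = tw_mul x y + iota a.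
Proof.
by rewrite /tw_mul tw_cocycle_iotal (addrAC x) [LHS]addrAC.
Qed.

Lemma tw_assoc_mulr x y z w :
  tw_assoc x y (tw_mul z w) = tw_assoc x y z + tw_assoc x y w.
Proof.
rewrite /tw_assoc /tw_mul !(td_tauDl, td_tauDm, td_tauDr).
by rewrite td_tau_iotam td_tau_iotam td_tau_iotar; ring.
Qed.

Lemma tw_inv x : loop_inv (x : twloop) = - x.
Proof.
apply: (@lmulI twloop x); rewrite loop_mulV /= /tw_mul subrr add0r.
by rewrite /tw_cocycle !td_tauNm !td_alt oppr0 !mulr0 addr0 td_iota0.
Qed.

Lemma tw_aip : automorphic_inverse twloop.
Proof.
move=> x y; rewrite !tw_inv /= /tw_mul !opprD -td_iotaN.
congr (_ + iota _); rewrite /tw_cocycle !td_tauNl !td_tauNm !td_tauNr.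
by ring.
Qed.

(** The inner mapping is v -> v + iota(tw_assoc x y v), and [tw_assoc] is additive in its last
    argument. *)
Lemma tw_inner_morph : inner_morph twloop.
Proof.
have key x y v (u : twloop) :
    tw_mul x (tw_mul y v) = tw_mul (tw_mul x y) u -> u = v + iota (tw_assoc x y v).
  rewrite tw_assocP -tw_mul_iotar => E.
  by apply: (@lmulI twloop (tw_mul x y)); rewrite /= E.
move=> x y z w v u /= /key -> /key ->.
rewrite tw_assocP tw_assoc_mulr tw_mul_iotal !tw_mul_iotar.
by rewrite (td_iotaD d (tw_assoc x y z)) addrA [RHS]addrAC.
Qed.

Lemma tw_commutative : t = - s -> commutative (@lmul twloop).
Proof.
move=> ts x y; rewrite /= /tw_mul (addrC x); congr (_ + iota _).
by rewrite /tw_cocycle ts (td_tauC x y x) (td_tauC x y y); ring.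
Qed.

Lemma tw_ca : t = - s -> commutative_automorphic_loop twloop.
Proof.
move=> ts; split; first exact: tw_commutative.
by apply: inner_morph_automorphic; [exact: tw_commutative | exact: tw_inner_morph].
Qed.

(** The Bol identity amounts to assoc(y,x,z) + assoc(x,yx,z) = 0; the left side is (t -
    2s)(tau(y,z,x) + tau(x,z,y) + tau(x,z,x)). *)
Lemma tw_bruck : t = s + s -> bruck_loop twloop.
Proof.
move=> ts; split; last exact: tw_aip.
move=> x y z /=; rewrite (tw_assocP y x z) tw_mul_iotar (tw_assocP x (tw_mul y x) z).
rewrite -addrA -(td_iotaD d (tw_assoc x _ z)) -[RHS]addr0; congr (_ + _).
apply: etrans td_iota0; congr td_iota.
rewrite /tw_assoc /tw_mul ts !(td_tauDl, td_tauDm, td_tauDr).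
rewrite !(td_tau_iotal, td_tau_iotam, td_tau_iotar).
rewrite !td_alt (td_tauC x y) (td_tauC z x y).
by ring.
Qed.

End TwistedLoop.

(** * Untwisting a central extension into an abelian group *)

Section AbelianWrapper.

Variables (T : finType) (add : T -> T -> T) (zero : T) (opp : T -> T).
Hypotheses (addA : associative add) (addC : commutative add).
Hypotheses (add0 : left_id zero add) (addN : left_inverse zero opp add).

(** The proofs are arguments of the alias, so that each operation on [T] determines its own
    canonical structure. *)
Definition abelian_wrap of associative add & commutative add &
  left_id zero add & left_inverse zero opp add : Type := T.
Local Notation W := (abelian_wrap addA addC add0 addN).

HB.instance Definition _ := Finite.on W.
HB.instance Definition _ := GRing.isZmodule.Build W addA addC add0 addN.

Definition abelian_finZmod : finZmodType := W.

End AbelianWrapper.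

Section TwistOfLoop.

Variables (p : nat) (L : finLoop) (c : L) (cC : central c).
Hypotheses (p_prime : prime p) (p_gt2 : (2 < p)%N) (oc : #[ltrans c]%g = p).
Hypothesis abQ : abelian_loop (central_quotient cC).
Variables (tau : L -> L -> L -> 'F_p) (s t : 'F_p).
Hypothesis tauDl : forall x x' y z, tau (x ⋅ x') y z = tau x y z + tau x' y z.
Hypothesis tauDm : forall x y y' z, tau x (y ⋅ y') z = tau x y z + tau x y' z.
Hypothesis tauDr : forall x y z z', tau x y (z ⋅ z') = tau x y z + tau x y z'.
Hypothesis tau_alt : forall x z, tau x x z = 0.
Hypothesis tau_proj : forall x x' y y' z z', cproj c x = cproj c x' ->
  cproj c y = cproj c y' -> cproj c z = cproj c z' -> tau x y z = tau x' y' z'.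

Local Notation sh := (@fshift p L c).

Definition ext_cocycle x y := s * tau x y x + t * tau x y y.
(** The group lives on the carrier of [L], so that the identity map is the isomorphism with the
    twisted loop. *)
Definition ext_add x y := sh (- ext_cocycle x y) (x ⋅ y).
Definition ext_opp x := sh (ext_cocycle x (loop_inv x)) (loop_inv x).

Hypothesis tau_alpha : forall x y z, alpha p c x y z =
  ext_cocycle y z + ext_cocycle x (y ⋅ z) - ext_cocycle x y - ext_cocycle (x ⋅ y) z.

Let proj_sh a x : cproj c (sh a x) = cproj c x.
Proof. by apply/esym/(cproj_fshift p_prime oc); exists a. Qed.

Lemma ext_cocycle_proj x x' y y' : cproj c x = cproj c x' ->
  cproj c y = cproj c y' -> ext_cocycle x y = ext_cocycle x' y'.
Proof. by move=> Ex Ey; rewrite /ext_cocycle (tau_proj Ex Ey Ex) (tau_proj Ex Ey Ey). Qed.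

Lemma tau1 y z : [/\ tau e y z = 0, tau y e z = 0 & tau y z e = 0].
Proof.
have idem (a : 'F_p) : a = a + a -> a = 0.
  by move=> E; apply: (@addrI _ a); rewrite addr0 -E.
by split; apply: idem; [rewrite -tauDl|rewrite -tauDm|rewrite -tauDr]; rewrite lmul1l.
Qed.

Lemma ext_addA : associative ext_add.
Proof.
move=> x y z; rewrite /ext_add.
rewrite (@ext_cocycle_proj x x (sh _ _) (y ⋅ z)) ?proj_sh //.
rewrite (@ext_cocycle_proj (sh _ _) (x ⋅ y) z z) ?proj_sh //.
rewrite fshift_mulr // fshift_mull // (alphaP p_prime oc abQ) !(fshiftD p_prime oc).
by rewrite tau_alpha; congr fshift; ring.
Qed.

Lemma ext_add0 : left_id e ext_add.
Proof.
move=> x; rewrite /ext_add /ext_cocycle; have [-> _ _] := tau1 x e.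
by have [-> _ _] := tau1 x x; rewrite !mulr0 addr0 oppr0 fshift0 lmul1l.
Qed.

Lemma ext_addN x : ext_add x (ext_opp x) = e.
Proof.
rewrite /ext_add /ext_opp (@ext_cocycle_proj x x _ (loop_inv x)) ?proj_sh //.
by rewrite fshift_mulr // loop_mulV (fshiftD p_prime oc) addNr fshift0.
Qed.

Lemma fshift_ext a x : sh a x = ext_add x (sh a e).
Proof.
rewrite /ext_add (@ext_cocycle_proj x x _ e) ?proj_sh // fshift_mulr // lmull1.
rewrite (fshiftD p_prime oc) /ext_cocycle; have [_ -> _] := tau1 x x.
by have [_ -> _] := tau1 x e; rewrite !mulr0 addr0 oppr0 add0r.
Qed.

Hypothesis ext_addC : commutative ext_add.

Lemma ext_addNl : left_inverse e ext_opp ext_add.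
Proof. by move=> x; rewrite ext_addC ext_addN. Qed.

Definition ext_zmod : finZmodType := abelian_finZmod ext_addA ext_addC ext_add0 ext_addNl.

Definition ext_iota (a : 'F_p) : ext_zmod := sh a e.

Lemma ext_iotaD : {morph ext_iota : a b / a + b}.
Proof.
move=> a b; rewrite -[RHS]/(ext_add (sh a e) (sh b e)).
by rewrite -fshift_ext (fshiftD p_prime oc) addrC.
Qed.

Let tau_add1 x y z w : tau (ext_add x y) z w = tau x z w + tau y z w.
Proof. by rewrite -tauDl; apply: tau_proj => //; apply: proj_sh. Qed.
Let tau_add2 x y z w : tau z (ext_add x y) w = tau z x w + tau z y w.
Proof. by rewrite -tauDm; apply: tau_proj => //; apply: proj_sh. Qed.
Let tau_add3 x y z w : tau z w (ext_add x y) = tau z w x + tau z w y.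
Proof. by rewrite -tauDr; apply: tau_proj => //; apply: proj_sh. Qed.
Let tau_iota1 a y z : tau (sh a e) y z = 0.
Proof. by have [<- _ _] := tau1 y z; apply: tau_proj => //; apply: proj_sh. Qed.
Let tau_iota3 a y z : tau y z (sh a e) = 0.
Proof. by have [_ _ <-] := tau1 y z; apply: tau_proj => //; apply: proj_sh. Qed.

Definition ext_data : twist_data p :=
  @TwistData p ext_zmod ext_iota tau ext_iotaD tau_add1
    (fun x y y' z => tau_add2 y y' x z) (fun x y z z' => tau_add3 z z' x y)
    tau_alt tau_iota1 tau_iota3.

Lemma card_ext_data : #|ext_data| = #|L|.
Proof. by apply: (@bij_eq_card _ _ (id : ext_zmod -> L)); exists id. Qed.

Lemma ext_loop_isomorphic : loop_isomorphic L (twloop ext_data s t).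
Proof.
exists (fun x : L => x : twloop ext_data s t); first by exists id.
move=> x y; rewrite -[RHS]/(ext_add (ext_add x y) (sh (ext_cocycle x y) e)).
by rewrite -fshift_ext (fshiftD p_prime oc) subrr fshift0.
Qed.

Lemma ext_iota_inj : injective ext_iota.
Proof. by move=> a b /(fshift_free cC p_prime oc). Qed.

End TwistOfLoop.

(** * Loops of either class as twisted abelian groups *)

Definition has_twist_form p (s t : 'F_p) (L : finLoop) := exists d : twist_data p,
  [/\ loop_isomorphic L (twloop d s t), #|d| = #|L|
    & injective (@td_iota p d) \/ forall x y z : d, td_tau x y z = 0].

Lemma abelian_loop_twist_form p (s t : 'F_p) (L : finLoop) :
  abelian_loop L -> has_twist_form s t L.
Proof.
case=> mA mC.
have mN : left_inverse e (@loop_inv L) (@lmul L) by move=> x; rewrite mC loop_mulV.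
pose W := abelian_finZmod mA mC (@lmul1l L) mN.
have D0 (a b : 'F_p) : 0 = 0 + 0 :> W by rewrite addr0.
have D1 (x y z w : W) : 0 = 0 + 0 :> 'F_p by rewrite addr0.
pose d := @TwistData p W (fun=> 0) (fun _ _ _ => 0) D0 D1 D1 D1
  (fun _ _ => erefl) (fun _ _ _ => erefl) (fun _ _ _ => erefl).
exists d; split; last (by right); last by apply: (@bij_eq_card _ _ (id : W -> L)); exists id.
exists (fun x : L => x : twloop d s t); first by exists id.
by move=> x y; rewrite -[RHS]/((x : W) + (y : W) + 0) addr0.
Qed.

Lemma ca_twist_form p (L : finLoop) : prime p -> (3 < p)%N -> #|L| = (p ^ 3)%N ->
  commutative_automorphic_loop L -> has_twist_form (1 : 'F_p) (- 1) L.
Proof.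
move=> pr p3 cardL caL; have p2 : (2 < p)%N by apply: leq_trans p3.
have [|abL|[c oc [cC abQ]]] := inner_morph_class2 pr p2 cardL caL _
    (fun n M cM hM => ca_center pr p2 cM hM).
- by move=> M f fM fS; apply: surj_ca fM fS caL.
- exact: abelian_loop_twist_form.
have lC := caL.1; have im := automorphic_inner_morph lC caL.2.
pose k : 'F_p := (3%:R)^-1.
have k3 : 3%:R * k = 1 by rewrite divff // Fp_nat_neq0.
pose A := alpha p c.
have AC x y z : A z y x = - A x y z := ca_alphaC pr oc abQ lC x y z.
have ADr x y z w : A x y (z ⋅ w) = A x y z + A x y w := alphaDr pr oc abQ im x y z w.
have ADl x x' y z : A (x ⋅ x') y z = A x y z + A x' y z.
  exact: (ca_alphaDl pr oc abQ im lC).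
have ADm x y y' z : A x (y ⋅ y') z = A x y z + A x y' z.
  exact: (ca_alphaDm pr p2 oc abQ im lC).
have Acyc x y z : A x y z + A y z x + A z x y = 0.
  exact: (ca_alpha_cyclic pr p2 oc abQ lC).
(* For (s,t) = (1,-1) the Jacobi identity reduces the twisted associator to -3 tau(x,z,y); this
   solves for tau. *)
pose tau x y z := - k * A x z y.
have A0 x y : A x y x = 0.
  by apply: (@Fp_double_eq0 p) => //; rewrite {2}AC subrr.
have tDl x x' y z : tau (x ⋅ x') y z = tau x y z + tau x' y z.
  by rewrite /tau ADl mulrDr.
have tDm x y y' z : tau x (y ⋅ y') z = tau x y z + tau x y' z.
  by rewrite /tau ADr mulrDr.
have tDr x y z z' : tau x y (z ⋅ z') = tau x y z + tau x y z'.
  by rewrite /tau ADm mulrDr.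
have talt x z : tau x x z = 0 by rewrite /tau A0 mulr0.
have tproj x x' y y' z z' : cproj c x = cproj c x' ->
    cproj c y = cproj c y' -> cproj c z = cproj c z' -> tau x y z = tau x' y' z'.
  by move=> Ex Ey Ez; rewrite /tau /A (alpha_proj pr oc abQ Ex Ez Ey).
have ta x y z : A x y z = ext_cocycle tau 1 (- 1) y z + ext_cocycle tau 1 (- 1) x (y ⋅ z)
    - ext_cocycle tau 1 (- 1) x y - ext_cocycle tau 1 (- 1) (x ⋅ y) z.
  have Az : A z x y = - A x y z - A y z x.
    by apply/eqP; rewrite -subr_eq0 -(Acyc x y z); apply/eqP; ring.
  have -> : A x y z = 3%:R * k * A x y z by rewrite k3 mul1r.
  rewrite /ext_cocycle /tau !(ADl, ADm, ADr) (AC y z x) (AC z x y) Az.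
  by ring.
have eC : commutative (ext_add c tau 1 (- 1)).
  move=> x y; rewrite /ext_add lC; congr (fshift _ _ _).
  rewrite /ext_cocycle /tau.
  by rewrite (AC x y y) (AC x x y); ring.
exists (ext_data pr oc abQ tDl tDm tDr talt tproj ta eC); split.
- exact: ext_loop_isomorphic.
- exact: card_ext_data.
- by left; apply: ext_iota_inj.
Qed.

Lemma bruck_twist_form p (L : finLoop) : prime p -> (3 < p)%N -> #|L| = (p ^ 3)%N ->
  bruck_loop L -> has_twist_form (1 : 'F_p) (1 + 1) L.
Proof.
move=> pr p3 cardL bL; have p2 : (2 < p)%N by apply: leq_trans p3.
have [|abL|[c oc [cC abQ]]] := inner_morph_class2 pr p2 cardL bL _
    (fun n M cM hM => bruck_center pr p2 cM hM).
- by move=> M f fM fS; apply: surj_bruck fM fS bL.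
- exact: abelian_loop_twist_form.
have [bol aip] := bL; have im := bruck_inner_morph pr p2 cardL bL.
have sq x : exists r : L, r ⋅ r = x.
  by have [g _ gK] := injF_bij (bruck_sqr_inj pr p2 cardL bL); exists (g x); apply: gK.
pose k : 'F_p := (3%:R)^-1.
have k3 : 3%:R * k = 1 by rewrite divff // Fp_nat_neq0.
pose A := alpha p c.
have AC x y z : A y x z = - A x y z := bruck_alphaC pr oc abQ im bol sq x y z.
have ADr x y z w : A x y (z ⋅ w) = A x y z + A x y w := alphaDr pr oc abQ im x y z w.
have ADl x x' y z : A (x ⋅ x') y z = A x y z + A x' y z.
  exact: (bruck_alphaDl pr oc abQ im bol sq).
have ADm x y y' z : A x (y ⋅ y') z = A x y z + A x y' z.
  exact: (bruck_alphaDm pr oc abQ im bol sq).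
have Acyc x y z : A x y z + A y z x + A z x y = 0.
  exact: (bruck_jacobi pr p2 oc abQ im bol sq).
have A0 x z : A x x z = 0.
  by apply: (@Fp_double_eq0 p) => //; rewrite {2}AC subrr.
(* For (s,t) = (1,2) the Jacobi identity reduces the twisted associator to 3 tau(x,y,z). *)
pose tau x y z := k * A x y z.
have tDl x x' y z : tau (x ⋅ x') y z = tau x y z + tau x' y z.
  by rewrite /tau ADl mulrDr.
have tDm x y y' z : tau x (y ⋅ y') z = tau x y z + tau x y' z.
  by rewrite /tau ADm mulrDr.
have tDr x y z z' : tau x y (z ⋅ z') = tau x y z + tau x y z'.
  by rewrite /tau ADr mulrDr.
have talt x z : tau x x z = 0 by rewrite /tau A0 mulr0.
have tproj x x' y y' z z' : cproj c x = cproj c x' ->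
    cproj c y = cproj c y' -> cproj c z = cproj c z' -> tau x y z = tau x' y' z'.
  by move=> Ex Ey Ez; rewrite /tau /A (alpha_proj pr oc abQ Ex Ey Ez).
pose F := ext_cocycle tau 1 (1 + 1).
have ta x y z : A x y z = F y z + F x (y ⋅ z) - F x y - F (x ⋅ y) z.
  have Az : A y z x = - A x y z - A z x y.
    by apply/eqP; rewrite -subr_eq0 -(Acyc x y z); apply/eqP; ring.
  have -> : A x y z = 3%:R * k * A x y z by rewrite k3 mul1r.
  rewrite /F /ext_cocycle /tau !(ADl, ADm, ADr) (AC z x y) Az.
  by ring.
pose ad := ext_add c tau 1 (1 + 1).
have eA : associative ad := ext_addA pr oc abQ tproj ta.
have e0 : left_id e ad by apply: ext_add0.
pose J := @loop_inv L.
have tau0 := tau1 tDl tDm tDr.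
have AJ1 x y z : tau (J x) y z = - tau x y z.
  apply/eqP; rewrite -subr_eq0 opprK addrC -tDl loop_mulV.
  by have [-> _ _] := tau0 y z.
have AJ2 x y z : tau x (J y) z = - tau x y z.
  apply/eqP; rewrite -subr_eq0 opprK addrC -tDm loop_mulV.
  by have [_ -> _] := tau0 x z.
have AJ3 x y z : tau x y (J z) = - tau x y z.
  apply/eqP; rewrite -subr_eq0 opprK addrC -tDr loop_mulV.
  by have [_ _ ->] := tau0 x y.
have JS (a : 'F_p) x : J (fshift c a x) = fshift c (- a) (J x).
  apply: (@lmulI _ (fshift c a x)); rewrite loop_mulV fshift_mull // fshift_mulr //.
  by rewrite loop_mulV (fshiftD pr oc) subrr fshift0.
have eN x : ad x (J x) = e.
  rewrite /ad /ext_add /ext_cocycle !AJ2 AJ3 !talt loop_mulV.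
  by rewrite !oppr0 !mulr0 addr0 oppr0 fshift0.
(* The loop inverse is also the inverse for [ad]. A group whose inversion is an automorphism is
   abelian. *)
have eJ x y : J (ad x y) = ad (J x) (J y).
  rewrite /ad /ext_add JS /J aip -/J; congr (fshift _ _ _).
  by rewrite /ext_cocycle !(AJ1, AJ2, AJ3); ring.
have eNl x : ad (J x) x = e by rewrite -{2}(bol_invK bL x) eN.
have adI x : injective (ad x).
  by move=> y z E; rewrite -[y]e0 -[z]e0 -(eNl x) -!eA E.
have eC : commutative ad.
  move=> x y; apply: (@adI (J (ad y x))); rewrite eNl eJ.
  have -> : ad (ad (J y) (J x)) (ad x y) = ad (J y) (ad (ad (J x) x) y) by rewrite !eA.
  by rewrite eNl e0 eNl.
exists (ext_data pr oc abQ tDl tDm tDr talt tproj ta eC); split.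
- exact: ext_loop_isomorphic.
- exact: card_ext_data.
- by left; apply: ext_iota_inj.
Qed.

(** * The seven models *)

Lemma mulrn_modn (V : zmodType) (x : V) n k : x *+ n = 0 -> x *+ (k %% n) = x *+ k.
Proof. by move=> x0; rewrite [in RHS](divn_eq k n) mulrnDr mulnC mulrnA x0 mul0rn add0r. Qed.

Lemma Zp_mulrnD (V : zmodType) n (x : V) : (1 < n)%N -> x *+ n = 0 ->
  {morph (fun i : 'Z_n => x *+ i) : i j / i + j}.
Proof.
by move=> n1 x0 i j /=; rewrite [X in (_ %% X)%N](Zp_cast n1) mulrn_modn // mulrnDr.
Qed.

Lemma Fp_mulrnD (V : zmodType) p (x : V) : prime p -> x *+ p = 0 ->
  {morph (fun i : 'F_p => x *+ i) : i j / i + j}.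
Proof.
by move=> pr x0; apply: Zp_mulrnD; rewrite pdiv_id // prime_gt1.
Qed.

Lemma mulrn_Fp0 p (a : 'F_p) : prime p -> a *+ p = 0.
Proof. by move=> pr; rewrite -mulr_natr pchar_Fp_0 // mulr0. Qed.

Section TwistModel.

Variables (p : nat) (E : finZmodType) (iota : 'F_p -> E) (q1 q2 : E -> 'F_p).
Variables l1 l2 : 'F_p.
Hypotheses (iotaD : {morph iota : a b / a + b}).
Hypotheses (q1D : {morph q1 : x y / x + y}) (q2D : {morph q2 : x y / x + y}).
Hypotheses (q1i : forall a, q1 (iota a) = 0) (q2i : forall a, q2 (iota a) = 0).

(** The determinant of [x] and [y] modulo [iota], times the form lambda with coefficients [l1],
    [l2]. *)
Definition model_tau x y z := (q1 x * q2 y - q2 x * q1 y) * (l1 * q1 z + l2 * q2 z).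

Lemma model_tauDl x x' y z : model_tau (x + x') y z = model_tau x y z + model_tau x' y z.
Proof. by rewrite /model_tau q1D q2D; ring. Qed.

Lemma model_tauDm x y y' z : model_tau x (y + y') z = model_tau x y z + model_tau x y' z.
Proof. by rewrite /model_tau q1D q2D; ring. Qed.

Lemma model_tauDr x y z z' : model_tau x y (z + z') = model_tau x y z + model_tau x y z'.
Proof. by rewrite /model_tau q1D q2D; ring. Qed.

Lemma model_tau_alt x z : model_tau x x z = 0.
Proof. by rewrite /model_tau; ring. Qed.

Lemma model_tau_iotal a y z : model_tau (iota a) y z = 0.
Proof. by rewrite /model_tau q1i q2i; ring. Qed.

Lemma model_tau_iotar a x y : model_tau x y (iota a) = 0.
Proof. by rewrite /model_tau q1i q2i; ring. Qed.

Definition model_data : twist_data p :=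
  @TwistData p E iota model_tau iotaD model_tauDl model_tauDm model_tauDr
    model_tau_alt model_tau_iotal model_tau_iotar.

End TwistModel.

HB.instance Definition _ (A B : finZmodType) := Finite.on (A * B)%type.

Definition prod_finZmod (A B : finZmodType) : finZmodType := (A * B)%type.

Section Models.

Variables (p : nat) (p_prime : prime p).

Let p2_gt1 : (1 < p ^ 2)%N.
Proof. by rewrite -(exp1n 2) ltn_exp2r // prime_gt1. Qed.

Definition modelE1 : finZmodType := prod_finZmod 'F_p (prod_finZmod 'F_p 'F_p).
Definition model_iota1 (a : 'F_p) : modelE1 := (0, (0, a)).

Lemma model_iota1D : {morph model_iota1 : a b / a + b}.
Proof. by move=> a b; rewrite /model_iota1 -[RHS]/(0 + 0, (0 + 0, a + b)) !addr0. Qed.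

Definition model1 l1 l2 : twist_data p :=
  @model_data p modelE1 model_iota1 fst (fun x => x.2.1) l1 l2
    model_iota1D (fun _ _ => erefl) (fun _ _ => erefl) (fun _ => erefl) (fun _ => erefl).

Definition modelE2 : finZmodType := prod_finZmod 'Z_(p ^ 2) 'F_p.
Definition model_iota2 (a : 'F_p) : modelE2 := (p%:R *+ a, 0).
Definition model_proj2 (x : modelE2) : 'F_p := 1 *+ (x.1 : 'Z_(p ^ 2)).

Lemma model_iota2D : {morph model_iota2 : a b / a + b}.
Proof.
move=> a b; rewrite /model_iota2 -[RHS]/(p%:R *+ a + p%:R *+ b, 0 + 0) addr0.
congr pair; apply: Fp_mulrnD => //.
by rewrite -mulrnA mulnn pchar_Zp.
Qed.

Lemma model_proj2D : {morph model_proj2 : x y / x + y}.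
Proof.
move=> x y; apply: (Zp_mulrnD (V := 'F_p) (x := 1)) => //.
by rewrite natrX pchar_Fp_0 // expr0n.
Qed.

Lemma model_proj2_iota a : model_proj2 (model_iota2 a) = 0.
Proof.
rewrite /model_proj2 /model_iota2 /= -mulrnA val_Zp_nat // [LHS]mulrn_modn.
  by rewrite natrM pchar_Fp_0 // mul0r.
by rewrite natrX pchar_Fp_0 // expr0n.
Qed.

(** Here p x = iota(q1 x), so mu is the first coordinate: with lambda nonzero, l2 = 0 is the
    parallel case and l2 <> 0 the independent one. *)
Definition model2 l1 l2 : twist_data p :=
  @model_data p modelE2 model_iota2 model_proj2 snd l1 l2
    model_iota2D model_proj2D (fun _ _ => erefl) model_proj2_iota (fun _ => erefl).

Definition modelE3 : finZmodType := 'Z_(p ^ 3).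

Definition model3 : twist_data p :=
  @model_data p modelE3 (fun=> 0) (fun=> 0) (fun=> 0) 0 0
    (fun _ _ => esym (addr0 0)) (fun _ _ => esym (addr0 0)) (fun _ _ => esym (addr0 0))
    (fun _ => erefl) (fun _ => erefl).

Lemma card_modelE1 : #|modelE1| = (p ^ 3)%N.
Proof. by rewrite !card_prod card_Fp. Qed.

Lemma card_modelE2 : #|modelE2| = (p ^ 3)%N.
Proof. by rewrite card_prod card_Fp // card_ord Zp_cast // -expnSr. Qed.

Lemma card_modelE3 : #|modelE3| = (p ^ 3)%N.
Proof. by rewrite card_ord Zp_cast // -(exp1n 3) ltn_exp2r // prime_gt1. Qed.

End Models.

(** * Comparing twisted groups; the abelian groups of order p^3 *)

Lemma loop_isomorphic_refl L : loop_isomorphic L L.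
Proof. by exists id => //; exists id. Qed.

Lemma loop_isomorphic_sym L M : loop_isomorphic L M -> loop_isomorphic M L.
Proof.
case=> f [g fK gK] fM; exists g; first by exists f.
by move=> x y; apply: (can_inj fK); rewrite fM !gK.
Qed.

Lemma loop_isomorphic_trans L M N :
  loop_isomorphic L M -> loop_isomorphic M N -> loop_isomorphic L N.
Proof.
case=> f fB fM [g gB gM]; exists (g \o f); first exact: bij_comp.
by move=> x y /=; rewrite fM gM.
Qed.

Lemma morphMn (U V : zmodType) (f : U -> V) x n :
  {morph f : x y / x + y} -> f (x *+ n) = f x *+ n.
Proof.
move=> fD; elim: n => [|n IH]; first exact: morphD0.
by rewrite !mulrS fD IH.
Qed.

Lemma Fp_morphZ p (V : zmodType) (f : 'F_p -> V) a b :
  {morph f : x y / x + y} -> f (a * b) = f b *+ a.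
Proof. by move=> fD; rewrite -{1}[a]natr_Zp mulr_natl morphMn. Qed.

(** Only the composites of [td_iota] with [td_tau] are compared, so [f] may rescale [td_iota]; the
    scalars s, t pass through as integer multiples. *)
Lemma twloop_isomorphic p (d d' : twist_data p) (s t : 'F_p) (f : d -> d') :
  injective f -> (#|d'| <= #|d|)%N -> {morph f : x y / x + y} ->
  (forall x y z, f (td_iota (td_tau x y z)) = td_iota (td_tau (f x) (f y) (f z))) ->
  loop_isomorphic (twloop d s t) (twloop d' s t).
Proof.
move=> fI le fD ft; exists f; first exact: inj_card_bij.
move=> x y; rewrite /= /tw_mul !fD; congr (_ + _).
rewrite /tw_cocycle !td_iotaD !(Fp_morphZ _ _ (@td_iotaD p _)) fD.
by rewrite !(morphMn _ _ fD) !ft.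
Qed.

Lemma morph_inj (U V : zmodType) (f : U -> V) :
  {morph f : x y / x + y} -> (forall x, f x = 0 -> x = 0) -> injective f.
Proof.
move=> fD f0 x y E; apply/eqP; rewrite -subr_eq0; apply/eqP/f0.
by rewrite fD morphDN // E subrr.
Qed.

Lemma Zp_dvd_eq0 n (i : 'Z_n) : (1 < n)%N -> (n %| i)%N -> i = 0.
Proof.
move=> n1 di; apply/ord_inj/eqP; rewrite /= -[_ == _]/(_ == 0)%N.
by apply: contraTT di => i0; rewrite gtnNdvd ?lt0n // -{2}(Zp_cast n1).
Qed.

Lemma Fp_natr_eq0 p n : prime p -> (n%:R == 0 :> 'F_p) = (p %| n)%N.
Proof. by move=> pr; rewrite (dvdn_pcharf (pchar_Fp pr)). Qed.

Section AbelianModels.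

Variables (p : nat) (p_prime : prime p) (E : finZmodType).
Hypothesis cardE : #|E| = (p ^ 3)%N.

(** The cyclic factors have orders p^i with i > 0 and total exponent 3. Each order divides the
    preceding one, which fixes the order of the factors p^2 and p. *)
Lemma abelian_model_cases : [\/
  exists2 f : modelE1 p -> E, injective f & {morph f : x y / x + y},
  exists2 f : modelE2 p -> E, injective f & {morph f : x y / x + y} |
  exists2 f : modelE3 p -> E, injective f & {morph f : x y / x + y}].
Proof.
have abE : abelian [set: E] := FinRing.zmod_abelian _.
have [b defE tE] := abelian_structure abE.
have cb : (\prod_(x <- b) #[x]%g = p ^ 3)%N by rewrite (bigdprod_card defE) cardsT.
have p1 := prime_gt1 p_prime.
have lt1 k : (1 < p ^ k)%N = (0 < k)%N by rewrite -{1}(expn0 p) ltn_exp2l.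
have pk (x : E) : exists i, #[x]%g = (p ^ i)%N.
  have : (#[x]%g %| p ^ 3)%N by rewrite -cardE -cardsT order_dvdG ?in_setT.
  by case/(dvdn_pfactor _ _ p_prime) => i _ ->; exists i.
have o1 : all (fun x : E => (1 < #[x]%g)%N) b.
  by have := abelian_type_gt1 [set: E]; rewrite -tE all_map.
have srt : sorted [rel m n | (n %| m)%N] (map (@order E) b).
  by rewrite tE abelian_type_dvdn_sorted.
have ordP (x : E) i : #[x]%g = (p ^ i)%N -> x *+ (p ^ i) = 0.
  by move=> <-; rewrite -FinRing.zmodXgE expg_order.
have ordI (x : E) n k : #[x]%g = n -> x *+ k = 0 -> (n %| k)%N.
  by move=> <- E0; rewrite order_dvdn FinRing.zmodXgE E0.
have mem_cyc (x : E) k : x *+ k \in <[x]>%g by rewrite -FinRing.zmodXgE mem_cycle.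
have disj (A B : {group E}) (x y : E) : (A :&: B = 1)%g -> x \in A -> y \in B ->
    x + y = 0 -> x = 0 /\ y = 0.
  move=> AB xA yB xy; have xE : x = - y by apply/eqP; rewrite -addr_eq0 xy.
  have : x \in (A :&: B)%g by rewrite inE xA xE -FinRing.zmodVgE groupV.
  rewrite AB => /set1gP x0; rewrite x0 in xE xy *.
  by split=> //; move: xy; rewrite FinRing.zmod1gE add0r.
have F0 (q : E) (a : 'F_p) : #[q]%g = p -> q *+ a = 0 -> a = 0.
  move=> oq qa; apply: (@Zp_dvd_eq0 (pdiv p)); first by rewrite pdiv_id.
  by rewrite [X in (X %| _)%N]pdiv_id //; apply: ordI oq qa.
case: b defE {tE} cb o1 srt => [|x [|y [|z [|w b]]]] defE /=.
- by rewrite big_nil => /eqP; rewrite -{1}(expn0 p) eqn_exp2l.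
- rewrite big_cons big_nil muln1 => ox _ _; constructor 3.
  have x0 := ordP x 3 ox.
  exists (fun i : 'Z_(p ^ 3) => x *+ i); last first.
    by apply: Zp_mulrnD => //; rewrite -(exp1n 3) ltn_exp2r.
  apply: morph_inj => [|i /(ordI _ _ _ ox)].
    by apply: Zp_mulrnD => //; rewrite -(exp1n 3) ltn_exp2r.
  by apply: Zp_dvd_eq0; rewrite -(exp1n 3) ltn_exp2r.
- have [[i Ei] [j Ej]] := (pk x, pk y).
  rewrite !big_cons big_nil muln1 Ei Ej -expnD => /eqP.
  rewrite eqn_exp2l // !lt1 !andbT dvdn_Pexp2l // => /eqP ij /andP [i0 j0] ji.
  have {i0 j0 ij ji} [i2 j1] : i = 2 /\ j = 1%N by lia.
  subst i j; rewrite expn1 in Ej; constructor 2.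
  have x0 := ordP x 2 Ei; have y0 : y *+ p = 0 by apply: (ordP y 1%N); rewrite expn1.
  have p21 : (1 < p ^ 2)%N by rewrite -(exp1n 2) ltn_exp2r.
  pose f (w : modelE2 p) := x *+ w.1 + y *+ w.2.
  have fD : {morph f : v w / v + w}.
    move=> v w; rewrite /f -[(v + w).1]/(v.1 + w.1) -[(v + w).2]/(v.2 + w.2).
    by rewrite Zp_mulrnD // Fp_mulrnD // addrACA.
  exists f => //; apply: morph_inj => // -[u v]; rewrite /f /= => E0.
  have tixy : (<[x]> :&: <[y]> = 1)%g.
    by move: defE; rewrite !big_cons big_nil dprodg1 => /dprodP [].
  have [xu yv] := disj _ _ _ _ tixy (mem_cyc x u) (mem_cyc y v) E0.
  have -> : u = 0 by apply: Zp_dvd_eq0 => //; apply: ordI Ei xu.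
  by rewrite (F0 y v).
- have [[i Ei] [j Ej] [k Ek]] := And3 (pk x) (pk y) (pk z).
  rewrite !big_cons big_nil muln1 Ei Ej Ek -!expnD => /eqP.
  rewrite eqn_exp2l // !lt1 !andbT => /eqP ijk /and3P [i0 j0 k0] _.
  have {i0 j0 k0 ijk} [i1 j1 k1] : [/\ i = 1%N, j = 1%N & k = 1%N] by split; lia.
  subst i j k; rewrite !expn1 in Ei Ej Ek; constructor 1.
  have o0 (u : E) : #[u]%g = p -> u *+ p = 0.
    by move=> ou; apply: (ordP u 1%N); rewrite expn1.
  pose f (w : modelE1 p) := x *+ w.1 + (y *+ w.2.1 + z *+ w.2.2).
  have fD : {morph f : v w / v + w}.
    move=> v w; rewrite /f -[(v + w).1]/(v.1 + w.1) -[(v + w).2]/(v.2 + w.2).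
    rewrite -[(v.2 + w.2).1]/(v.2.1 + w.2.1) -[(v.2 + w.2).2]/(v.2.2 + w.2.2).
    by rewrite !(Fp_mulrnD p_prime (o0 _ _)) // [RHS]addrACA; congr (_ + _); apply: addrACA.
  exists f => //; apply: morph_inj => // -[u [v w]]; rewrite /f /= => E0.
  move: defE; rewrite !big_cons big_nil dprodg1 => /dprodP [[K H _ HE] _ _].
  rewrite HE => tixH.
  have [[_ _ _ _] yzH _ tiyz] := dprodP HE.
  have yzm : y *+ v + z *+ w \in H.
    by rewrite -yzH -FinRing.zmodMgE mem_mulg // mem_cyc.
  have [xu yzvw] := disj _ _ _ _ tixH (mem_cyc x u) yzm E0.
  have [yv zw] := disj _ _ _ _ tiyz (mem_cyc y v) (mem_cyc z w) yzvw.
  by rewrite (F0 x u) // (F0 y v) // (F0 z w).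
- have [[i Ei] [j Ej]] := (pk x, pk y); have [[k Ek] [l El]] := (pk z, pk w).
  rewrite !big_cons Ei Ej Ek El !mulnA -!expnD !lt1.
  move=> E0 /and5P [i0 j0 k0 l0 _] _.
  have : (p ^ (i + j + k + l) %| p ^ 3)%N by rewrite -E0 dvdn_mulr.
  by rewrite dvdn_Pexp2l //; lia.
Qed.

End AbelianModels.

(** * Normal forms *)

Section Nonsquare.

Variables (p : nat) (p_prime : prime p) (p_gt2 : (2 < p)%N).

Definition nonsquare : 'F_p := odflt 0 [pick a : 'F_p | [forall x : 'F_p, x ^+ 2 != a]].

(** The default 0 is never taken: were every element a square, squaring would be bijective on a
    finite set, contradicting (-1)^2 = 1^2. *)
Lemma nonsquareP x : x ^+ 2 != nonsquare.
Proof.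
rewrite /nonsquare; case: pickP => [a /forallP // |sq] /=.
have sq_surj (a : 'F_p) : exists y, y ^+ 2 == a.
  by have /negbT := sq a; rewrite negb_forall => /existsP [y /negPn Ey]; exists y.
pose r a := xchoose (sq_surj a).
have rK : cancel r (fun y => y ^+ 2) by move=> a; apply/eqP/(xchooseP (sq_surj a)).
have [h rh hr] := injF_bij (can_inj rK).
have hE y : h y = y ^+ 2 by rewrite -{2}(hr y) rK.
have : 1 = - 1 :> 'F_p by apply: (can_inj hr); rewrite !hE sqrrN.
move/eqP; rewrite -addr_eq0 => /eqP /(Fp_double_eq0 p_prime p_gt2) /eqP.
by rewrite oner_eq0.
Qed.

Lemma nonsquare_neq0 : nonsquare != 0.
Proof. by have := nonsquareP 0; rewrite expr0n eq_sym. Qed.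

Lemma square_class (a : 'F_p) : a != 0 ->
  exists2 b, b != 0 & a * b ^+ 2 = 1 \/ a * b ^+ 2 = nonsquare.
Proof.
move=> a0; pose sq := [set x ^+ 2 | x : 'F_p]; pose nsq := [set nonsquare * x | x in sq].
(* Pairing x^2 with a bit that tells x from -x is injective, so p <= 2 |sq|, and equality fails for
   odd p. Hence the squares and their multiples by [nonsquare], which meet at most in 0, cover the
   field. *)
have cardsq : (p < #|sq|.*2)%N.
  pose f (x : 'F_p) := (x ^+ 2, (x < (- x)%R)%N).
  have fI : injective f.
    move=> x y E; have /eqP : x ^+ 2 = y ^+ 2 := congr1 fst E.
    rewrite eqf_sqr => /orP [/eqP //|/eqP xy].
    have : (x < (- x)%R)%N = (y < (- y)%R)%N := congr1 snd E.
    by rewrite xy opprK; case: ltngtP => // E' _; apply/ord_inj.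
  have : (#|f @: [set: 'F_p]| <= #|setX sq [set: bool]|)%N.
    apply/subset_leq_card/subsetP => _ /imsetP [x _ ->]; rewrite inE /= in_setT andbT.
    exact: imset_f.
  rewrite card_imset // cardsX !cardsT card_bool card_Fp // muln2.
  rewrite leq_eqVlt => /orP [/eqP /(congr1 odd)|//].
  by rewrite odd_double (pnat_odd p_prime p_gt2 (pnat_id p_prime)).
have cardn : #|nsq| = #|sq| by rewrite card_imset //; apply: mulfI nonsquare_neq0.
have sqi : sq :&: nsq \subset [set 0].
  apply/subsetP=> _ /setIP [/imsetP [x _ ->] /imsetP [_ /imsetP [y _ ->]] E].
  rewrite inE; apply: contraT => x0; have := nonsquareP (x / y).
  rewrite expr_div_n E mulfK ?eqxx //; apply: contraNneq x0 => y0.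
  by rewrite E y0 mulr0.
have : a \in sq :|: nsq.
  suff -> : sq :|: nsq = [set: 'F_p] by rewrite in_setT.
  apply/eqP; rewrite eqEcard subsetT cardsT card_Fp // cardsU cardn addnn.
  have := subset_leq_card sqi; rewrite cards1 => le1.
  by move: cardsq le1; lia.
case/setUP=> [/imsetP [x _ E]|/imsetP [_ /imsetP [x _ ->]] E].
  have x0 : x != 0 by apply: contraNneq a0 => x0; rewrite E x0 expr0n.
  exists x^-1; first by rewrite invr_eq0.
  by left; rewrite E exprVn divff // expf_neq0.
have x0 : x != 0 by apply: contraNneq a0 => x0; rewrite E x0 expr0n mulr0.
exists x^-1; first by rewrite invr_eq0.
by right; rewrite E exprVn mulfK // expf_neq0.
Qed.

End Nonsquare.

Section Classification.

Variables (p : nat) (p_prime : prime p) (p_gt2 : (2 < p)%N) (d : twist_data p).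
Hypotheses (card_d : #|d| = (p ^ 3)%N) (iota_inj : injective (@td_iota p d)).
Local Notation iota := (@td_iota p d).
Local Notation tau := (@td_tau p d).
Implicit Types x y z : d.

Lemma td_tauMl x y z n : tau (x *+ n) y z = n%:R * tau x y z.
Proof.
rewrite mulr_natl; apply: (morphMn (f := fun x => tau x y z)) => u v.
exact: td_tauDl.
Qed.

Lemma td_tauMm x y z n : tau x (y *+ n) z = n%:R * tau x y z.
Proof.
rewrite mulr_natl; apply: (morphMn (f := fun y => tau x y z)) => u v.
exact: td_tauDm.
Qed.

Lemma td_tauMr x y z n : tau x y (z *+ n) = n%:R * tau x y z.
Proof. by rewrite mulr_natl; apply: morphMn => u v; apply: td_tauDr. Qed.

Lemma td_iota_mulp a : iota a *+ p = 0.
Proof. by rewrite -(morphMn _ _ (@td_iotaD p d)) mulrn_Fp0 // td_iota0. Qed.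

(** The map sends the model's [iota] to iota(c0 a), so tau(e1,e2,ei) is compared with c0 li. The
    witness [w] certifies that [e1] and [e2] are independent modulo [iota]. *)
Lemma twist_model1 (e1 e2 : d) (c0 l1 l2 : 'F_p) w : tau e1 e2 w != 0 -> c0 != 0 ->
  e1 *+ p = 0 -> e2 *+ p = 0 ->
  tau e1 e2 e1 = c0 * l1 -> tau e1 e2 e2 = c0 * l2 ->
  forall s t, loop_isomorphic (twloop (model1 l1 l2) s t) (twloop d s t).
Proof.
move=> t0 c00 p1 p2 t1 t2 s t.
pose f (v : modelE1 p) := e1 *+ v.1 + (e2 *+ v.2.1 + iota (c0 * v.2.2)).
have fD : {morph f : v w / v + w}.
  move=> v w'; rewrite /f -[(v + w').1]/(v.1 + w'.1) -[(v + w').2]/(v.2 + w'.2).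
  rewrite -[(v.2 + w'.2).1]/(v.2.1 + w'.2.1) -[(v.2 + w'.2).2]/(v.2.2 + w'.2.2).
  rewrite mulrDr td_iotaD !Fp_mulrnD // [RHS]addrACA; congr (_ + _); exact: addrACA.
have f1 y z v : tau (f v) y z = v.1 * tau e1 y z + v.2.1 * tau e2 y z.
  by rewrite /f !td_tauDl td_tau_iotal addr0 !td_tauMl !natr_Zp.
have f2 y z v : tau y (f v) z = v.1 * tau y e1 z + v.2.1 * tau y e2 z.
  by rewrite /f !td_tauDm td_tau_iotam addr0 !td_tauMm !natr_Zp.
have f3 y z v : tau y z (f v) = v.1 * tau y z e1 + v.2.1 * tau y z e2.
  by rewrite /f !td_tauDr td_tau_iotar addr0 !td_tauMr !natr_Zp.
apply: (@twloop_isomorphic p (model1 l1 l2) d s t f) => //.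
- apply: morph_inj => // v fv.
  have v1 : v.1 = 0.
    have := f1 e2 w v; rewrite fv td_tau0l td_alt mulr0 addr0 => /esym/eqP.
    by rewrite mulf_eq0 (negPf t0) orbF => /eqP.
  have v2 : v.2.1 = 0.
    have := f2 e1 w v; rewrite fv td_tau0m td_alt mulr0 add0r => /esym/eqP.
    by rewrite mulf_eq0 (negPf t0) orbF => /eqP.
  have v3 : v.2.2 = 0.
    move: fv; rewrite /f v1 v2 !mulr0n !add0r -(td_iota0 d) => /iota_inj /eqP.
    by rewrite mulf_eq0 (negPf c00) => /eqP.
  by case: v v1 v2 v3 {fv} => [? [? ?]] /= -> -> ->.
- by rewrite card_d card_modelE1.
move=> x y z; pose a := model_tau fst (fun x : modelE1 p => x.2.1) l1 l2 x y z.
rewrite -[LHS]/(e1 *+ 0%N + (e2 *+ 0%N + iota (c0 * a))) !mulr0n !add0r.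
congr (iota _); rewrite /a.
rewrite f1 !f2 !f3 !td_alt (td_tauC e1 e2 e1) (td_tauC e1 e2 e2) t1 t2 /model_tau.
ring.
Qed.

(** As in [twist_model1], but the scale [c0] is now dictated by p e1, since the model's [iota] is p
    times its first generator. *)
Lemma twist_model2 (e1 e2 : d) (c0 l1 l2 : 'F_p) w : tau e1 e2 w != 0 -> c0 != 0 ->
  e1 *+ p = iota c0 -> e2 *+ p = 0 ->
  tau e1 e2 e1 = c0 * l1 -> tau e1 e2 e2 = c0 * l2 ->
  forall s t, loop_isomorphic (twloop (model2 p_prime l1 l2) s t) (twloop d s t).
Proof.
move=> t0 c00 p1 p2 t1 t2 s t.
have p21 : (1 < p ^ 2)%N by rewrite -(exp1n 2) ltn_exp2r // prime_gt1.
have p1' : e1 *+ (p ^ 2) = 0 by rewrite -mulnn mulrnA p1 td_iota_mulp.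
have iotaM a k : iota a *+ k = iota (a * k%:R).
  by rewrite mulr_natr (morphMn _ _ (@td_iotaD p d)).
pose f (v : modelE2 p) := e1 *+ v.1 + e2 *+ v.2.
have fD : {morph f : v w / v + w}.
  move=> v w'; rewrite /f -[(v + w').1]/(v.1 + w'.1) -[(v + w').2]/(v.2 + w'.2).
  by rewrite Zp_mulrnD // Fp_mulrnD // addrACA.
pose q := @model_proj2 p.
have f1 y z v : tau (f v) y z = q v * tau e1 y z + v.2 * tau e2 y z.
  by rewrite /f !td_tauDl !td_tauMl natr_Zp.
have f2 y z v : tau y (f v) z = q v * tau y e1 z + v.2 * tau y e2 z.
  by rewrite /f !td_tauDm !td_tauMm natr_Zp.
have f3 y z v : tau y z (f v) = q v * tau y z e1 + v.2 * tau y z e2.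
  by rewrite /f !td_tauDr !td_tauMr natr_Zp.
apply: (@twloop_isomorphic p (model2 p_prime l1 l2) d s t f) => //.
- apply: morph_inj => // v fv.
  have v1 : q v = 0.
    have := f1 e2 w v; rewrite fv td_tau0l td_alt mulr0 addr0 => /esym/eqP.
    by rewrite mulf_eq0 (negPf t0) orbF => /eqP.
  have v2 : v.2 = 0.
    have := f2 e1 w v; rewrite fv td_tau0m td_alt mulr0 add0r => /esym/eqP.
    by rewrite mulf_eq0 (negPf t0) orbF => /eqP.
  have {}v1 : v.1 = 0.
    move/eqP: v1; rewrite [q v == 0](Fp_natr_eq0 _ p_prime) => /dvdnP [k Ek].
    move: fv; rewrite /f v2 mulr0n addr0 Ek mulnC mulrnA p1 iotaM.
    rewrite -(td_iota0 d) => /iota_inj /eqP.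
    rewrite mulf_eq0 (negPf c00) /= (Fp_natr_eq0 _ p_prime) => dk.
    by apply: Zp_dvd_eq0 => //; rewrite Ek -mulnn dvdn_pmul2r // prime_gt0.
  by case: v v1 v2 {fv} => ? ? /= -> ->.
- by rewrite card_d card_modelE2.
move=> x y z; pose a := model_tau q snd l1 l2 x y z.
transitivity (iota (c0 * a)).
  rewrite -[LHS]/(e1 *+ (p%:R *+ a : 'Z_(p ^ 2)) + e2 *+ 0%N) mulr0n addr0.
  rewrite -mulrnA val_Zp_nat // mulrn_modn // mulrnA p1 iotaM.
  by rewrite natr_Zp.
congr (iota _); rewrite /a.
rewrite f1 !f2 !f3 !td_alt (td_tauC e1 e2 e1) (td_tauC e1 e2 e2) t1 t2 /model_tau.
ring.
Qed.

Section NormalForm.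

Variables (u v w : d).
Hypothesis t0 : tau u v w != 0.

Let p1 x := tau x v w / tau u v w.
Let p2 x := tau u x w / tau u v w.

(** [p1] and [p2] are Cramer coordinates: as tau is alternating and vanishes on iota, they read off
    the coefficients of [u] and [v]. The p^3 combinations are therefore distinct and fill [d]. *)
Lemma twist_decomposition x : exists c, x = u *+ p1 x + (v *+ p2 x + iota c).
Proof.
pose f (a : 'F_p * ('F_p * 'F_p)) := u *+ a.1 + (v *+ a.2.1 + iota a.2.2).
have fE a : p1 (f a) = a.1 /\ p2 (f a) = a.2.1.
  rewrite /p1 /p2 /f !(td_tauDl, td_tauDm) td_tau_iotal td_tau_iotam.
  rewrite !(td_tauMl, td_tauMm) !natr_Zp !td_alt !mulr0 !addr0 add0r.
  by rewrite !mulfK.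
have fI : injective f.
  move=> [a [b c]] [a' [b' c']] E.
  have [[E1 E2] [E1' E2']] := (fE (a, (b, c)), fE (a', (b', c'))).
  have aa : a = a' := etrans (esym E1) (etrans (congr1 p1 E) E1').
  have bb : b = b' := etrans (esym E2) (etrans (congr1 p2 E) E2').
  by move: E; rewrite aa bb => /addrI /addrI /iota_inj /= ->.
have [|g _ gK] := inj_card_bij fI.
  by rewrite !card_prod card_Fp // card_d.
exists (g x).2.2; rewrite -{1}(gK x) {1}/f.
by have [<- <-] := fE (g x); rewrite gK.
Qed.

Lemma twist_tau_coord x y z : tau x y z =
  (p1 x * p2 y - p2 x * p1 y) * (p1 z * tau u v u + p2 z * tau u v v).
Proof.
have [[a xE] [b yE] [c zE]] := And3 (twist_decomposition x) (twist_decomposition y)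
  (twist_decomposition z).
rewrite {1}xE {1}yE {1}zE !(td_tauDl, td_tauDm, td_tauDr).
rewrite !(td_tau_iotal, td_tau_iotam, td_tau_iotar).
rewrite !(td_tauMl, td_tauMm, td_tauMr) !natr_Zp !td_alt !(td_tauC u v).
ring.
Qed.

Lemma twist_pmul x : exists c, x *+ p = iota c.
Proof.
have [c xE] := twist_decomposition (x *+ p).
have z0 : p%:R = 0 :> 'F_p by rewrite pchar_Fp_0.
move: xE; rewrite /p1 /p2 td_tauMl td_tauMm z0 !mul0r.
by rewrite -[u *+ _]/(u *+ 0%N) -[v *+ _]/(v *+ 0%N) !mulr0n !add0r; exists c.
Qed.

Definition twist_mu x : 'F_p := odflt 0 [pick c | x *+ p == iota c].

Lemma twist_muP x : x *+ p = iota (twist_mu x).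
Proof.
have [c E] := twist_pmul x; rewrite /twist_mu; case: pickP => [b /eqP //|/(_ c)].
by rewrite E eqxx.
Qed.

Local Notation mu := twist_mu.

Lemma twist_muD : {morph mu : x y / x + y}.
Proof. by move=> x y; apply: iota_inj; rewrite td_iotaD -!twist_muP mulrnDl. Qed.

Definition tvec (a b : 'F_p) : d := u *+ a + v *+ b.

Lemma tvec_tau a b a' b' a'' b'' : tau (tvec a b) (tvec a' b') (tvec a'' b'') =
  (a * b' - b * a') * (a'' * tau u v u + b'' * tau u v v).
Proof.
rewrite /tvec !(td_tauDl, td_tauDm, td_tauDr) !(td_tauMl, td_tauMm, td_tauMr).
by rewrite !natr_Zp !td_alt !(td_tauC u v); ring.
Qed.

Lemma tvec_tauw a b a' b' :
  tau (tvec a b) (tvec a' b') w = (a * b' - b * a') * tau u v w.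
Proof.
rewrite /tvec !(td_tauDl, td_tauDm) !(td_tauMl, td_tauMm).
by rewrite !natr_Zp !td_alt !(td_tauC u v); ring.
Qed.

Lemma tvec_pmul a b : tvec a b *+ p = iota (a * mu u + b * mu v).
Proof.
rewrite twist_muP /tvec twist_muD !(morphMn _ _ twist_muD) -!(mulr_natl (mu _)).
by rewrite !natr_Zp.
Qed.

Lemma nonzero_pairing (x y : 'F_p) : (x != 0) || (y != 0) ->
  exists a b, a * x + b * y != 0.
Proof.
case/orP=> [x0|y0]; first by exists 1, 0; rewrite mul1r mul0r addr0.
by exists 0, 1; rewrite mul1r mul0r add0r.
Qed.

Lemma lam_neq0 : (tau u v u != 0) || (tau u v v != 0).
Proof.
apply: contraNT t0; rewrite negb_or !negbK => /andP [/eqP L1 /eqP L2].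
by rewrite (twist_tau_coord u v w) L1 L2 !mulr0 addr0 mulr0.
Qed.

Lemma twist_normal_form (s t : 'F_p) : [\/
  loop_isomorphic (twloop (model1 1 0) s t) (twloop d s t),
  loop_isomorphic (twloop (model2 p_prime 1 0) s t) (twloop d s t),
  loop_isomorphic (twloop (model2 p_prime 0 1) s t) (twloop d s t) |
  loop_isomorphic (twloop (model2 p_prime 0 (nonsquare p)) s t) (twloop d s t)].
Proof.
set L1 := tau u v u; set L2 := tau u v v; set M1 := mu u; set M2 := mu v.
have [M0|] := boolP ((M1 == 0) && (M2 == 0)).
  have /andP [/eqP M10 /eqP M20] := M0.
  have [a [b l0]] := nonzero_pairing lam_neq0; rewrite -/L1 -/L2 in l0.
  set l := _ + _ in l0; constructor 1.
  (* The second vector spans the kernel of lambda. The determinant is -l and lambda is l on the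
     first vector, whence the scale -l^2. *)
  apply: (@twist_model1 (tvec a b) (tvec L2 (- L1)) (- l ^+ 2) _ _ w).
  - by rewrite tvec_tauw mulf_neq0 // mulrN -opprD oppr_eq0.
  - by rewrite oppr_eq0 expf_neq0.
  - by rewrite tvec_pmul -/M1 -/M2 M10 M20 !mulr0 addr0 td_iota0.
  - by rewrite tvec_pmul -/M1 -/M2 M10 M20 !mulr0 addr0 td_iota0.
  - by rewrite tvec_tau -/L1 -/L2 /l; ring.
  - by rewrite tvec_tau -/L1 -/L2 /l; ring.
rewrite negb_and => MN0.
have [D0|D0] := eqVneq (L2 * M1 - L1 * M2) 0.
  have [a [b m0]] := nonzero_pairing MN0; set m := _ + _ in m0; constructor 2.
  have l0 : a * L1 + b * L2 != 0.
    apply/eqP => l0; have := lam_neq0; rewrite -/L1 -/L2.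
    have /eqP : m * L1 = 0.
      by transitivity (M1 * (a * L1 + b * L2) - b * (L2 * M1 - L1 * M2));
        [rewrite /m; ring | rewrite l0 D0 !mulr0 subr0].
    have /eqP : m * L2 = 0.
      by transitivity (M2 * (a * L1 + b * L2) + a * (L2 * M1 - L1 * M2));
        [rewrite /m; ring | rewrite l0 D0 !mulr0 addr0].
    by rewrite !mulf_eq0 (negPf m0) /= => -> ->.
  (* The second vector spans the kernel of mu, and [be] normalises it: tau(e1,e2,e1) = -be m l must
     equal the scale m = mu(e1). *)
  set l := _ + _ in l0; pose be := - l^-1.
  have bl : be * l = - 1 by rewrite mulNr mulVf.
  have be0 : be != 0 by rewrite oppr_eq0 invr_eq0.
  apply: (@twist_model2 (tvec a b) (tvec (be * M2) (- (be * M1))) m _ _ w) => //.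
  - rewrite tvec_tauw mulf_neq0 //.
    have -> : a * - (be * M1) - b * (be * M2) = - (be * m) by rewrite /m; ring.
    by rewrite oppr_eq0 mulf_neq0.
  - by rewrite tvec_pmul.
  - rewrite tvec_pmul -/M1 -/M2; apply: etrans (td_iota0 d).
    by congr td_iota; ring.
  - rewrite tvec_tau -/L1 -/L2 -/l.
    transitivity (- (be * l) * m); first by rewrite /m; ring.
    by rewrite bl opprK mulrC.
  - rewrite tvec_tau -/L1 -/L2.
    transitivity (be ^+ 2 * m * (L2 * M1 - L1 * M2)); first by rewrite /m; ring.
    by rewrite D0 !mulr0.
have [be be0 sqD] := square_class p_prime p_gt2 D0.
set D := _ - _ in D0 sqD.
have key l2 : D * be ^+ 2 = l2 ->
    loop_isomorphic (twloop (model2 p_prime 0 l2) s t) (twloop d s t).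
  move=> El2.
  (* The vectors span the kernels of lambda and of mu. The scale is mu(e1) = D, and tau(e1,e2,e2) =
     (be D)^2 = D l2; so [be] changes l2 by squares. *)
  apply: (@twist_model2 (tvec L2 (- L1)) (tvec (be * M2) (- (be * M1))) D _ _ w) => //.
  - rewrite tvec_tauw mulf_neq0 //.
    have -> : L2 * - (be * M1) - - L1 * (be * M2) = - (be * D) by rewrite /D; ring.
    by rewrite oppr_eq0 mulf_neq0.
  - by rewrite tvec_pmul; congr td_iota; rewrite -/M1 -/M2 /D; ring.
  - rewrite tvec_pmul -/M1 -/M2; apply: etrans (td_iota0 d).
    by congr td_iota; ring.
  - by rewrite tvec_tau -/L1 -/L2; ring.
  - by rewrite tvec_tau -/L1 -/L2 -El2 /D; ring.
by case: sqD => /key; [constructor 3 | constructor 4].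
Qed.

End NormalForm.

End Classification.

(** * Isomorphism invariants *)

Definition lpow (L : finLoop) k (x : L) : L := iter k (lmul x) e.

Definition right_alt (L : finLoop) (y x : L) := y ⋅ (x ⋅ x) == (y ⋅ x) ⋅ x.

Section Invariants.

Variables (p k : nat).

Definition exponent_dvd n (L : finLoop) := [forall x : L, lpow n x == e].

Definition right_alternative (L : finLoop) :=
  [forall x : L, forall y : L, right_alt y x].

(** On the models of exponent p^2, the elements killed by p form the kernel of mu, and the test says
    that lambda vanishes there. *)
Definition right_alternative_mod (L : finLoop) :=
  [forall x : L, (lpow p x == e) ==> [forall y : L, right_alt y x]].

(* On the models with lambda and mu independent this tests whether l2 is a
   square, see [model2_square_associator]. *)
Definition square_associator (L : finLoop) :=
  [exists x : L, exists y : L, [&& lpow p y == e, lpow p x != e &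
    x ⋅ (y ⋅ y) == ((x ⋅ y) ⋅ y) ⋅ lpow k (lpow p x)]].

(** The values are arranged so that the i-th entry of [model_list] has code i. *)
Definition loop_code (L : finLoop) : nat :=
  if right_alternative L then
    if exponent_dvd p L then 0 else if exponent_dvd (p ^ 2) L then 1 else 2
  else if exponent_dvd p L then 3 else
    if right_alternative_mod L then 4 else if square_associator L then 5 else 6.

Section Isomorphism.

Variables (L M : finLoop) (f : L -> M).
Hypotheses (fB : bijective f) (fM : {morph f : x y / x ⋅ y}).

Let f_surj y : exists x, f x = y.
Proof. by case: fB => g _ gK; exists (g y). Qed.

Let f1 : f e = e. Proof. exact: surj_morph1. Qed.

Lemma lpow_morph n x : f (lpow n x) = lpow n (f x).
Proof. by elim: n => [|n IH]; rewrite /lpow ?f1 //= fM -/(lpow n x) IH. Qed.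

Let lpow1 n x : (lpow n (f x) == e) = (lpow n x == e).
Proof. by rewrite -lpow_morph -f1 (bij_eq fB). Qed.

Let forallE (P : pred L) (R : pred M) : (forall x, R (f x) = P x) ->
  [forall x, P x] = [forall y, R y].
Proof.
move=> PR; apply/forallP/forallP => [H y|H x]; last by rewrite -PR.
by have [x <-] := f_surj y; rewrite PR.
Qed.

Let existsE (P : pred L) (R : pred M) : (forall x, R (f x) = P x) ->
  [exists x, P x] = [exists y, R y].
Proof.
move=> PR; apply/existsP/existsP => [[x]|[y]]; first by rewrite -PR; exists (f x).
by have [x <-] := f_surj y; rewrite PR; exists x.
Qed.

Let right_altE y x : right_alt (f y) (f x) = right_alt y x.
Proof. by rewrite /right_alt -!fM (bij_eq fB). Qed.

Lemma loop_code_morph : loop_code L = loop_code M.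
Proof.
have E1 n : exponent_dvd n L = exponent_dvd n M by apply: forallE => x; rewrite lpow1.
have E2 : right_alternative L = right_alternative M.
  by apply: forallE => x; apply/esym/forallE => y; rewrite right_altE.
have E3 : right_alternative_mod L = right_alternative_mod M.
  apply: forallE => x; rewrite lpow1; congr (_ ==> _).
  by apply/esym/forallE => y; rewrite right_altE.
have E4 : square_associator L = square_associator M.
  apply: existsE => x; apply/esym/existsE => y.
  by rewrite !lpow1 -!lpow_morph -!fM (bij_eq fB).
by rewrite /loop_code !E1 E2 E3 E4.
Qed.

End Isomorphism.

Lemma loop_code_isomorphic L M : loop_isomorphic L M -> loop_code L = loop_code M.
Proof. by case=> f; apply: loop_code_morph. Qed.

End Invariants.

(** * The invariants on twisted groups and on the seven models *)

Section TwistInvariants.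

Variables (p : nat) (p_prime : prime p) (d : twist_data p) (s t : 'F_p).
Local Notation iota := (@td_iota p d).
Local Notation tau := (@td_tau p d).
Local Notation L := (twloop d s t).

Lemma lpow_twloop k (x : L) : lpow k x = (x : d) *+ k.
Proof.
elim: k => // k IH; rewrite /lpow iterS -/(lpow k x) IH /= /tw_mul -mulrS.
by rewrite /tw_cocycle !td_tauMm !td_alt !mulr0 addr0 td_iota0 addr0.
Qed.

(** At (x,y,y) the last term of [tw_assoc] vanishes and the other two merge, which produces the
    scalar 2t - s. *)
Lemma twloop_assoc_sqr (x y : L) :
  x ⋅ (y ⋅ y) = ((x ⋅ y) ⋅ y) ⋅ (iota ((t + t - s) * tau x y y) : L).
Proof.
rewrite /= tw_assocP -[iota ((t + t - s) * _)]add0r tw_mul_iotar tw_mull1.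
by congr (_ + iota _); rewrite /tw_assoc td_alt; ring.
Qed.

Lemma right_alt_twloop0 (x y : L) : tau y x x = 0 -> right_alt y x.
Proof.
by move=> E; rewrite /right_alt twloop_assoc_sqr E mulr0 td_iota0 lmull1.
Qed.

Lemma right_alt_twloop (x y : L) : injective iota -> t + t - s != 0 ->
  right_alt y x = (tau y x x == 0).
Proof.
move=> iota_inj st0.
rewrite /right_alt twloop_assoc_sqr -[X in _ == X]lmull1 (inj_eq (@lmulI L _)).
by rewrite -[e]/(0 : d) -(td_iota0 d) (inj_eq iota_inj) mulf_eq0 (negPf st0).
Qed.

End TwistInvariants.

Section ModelCodes.

Variables (p : nat) (p_prime : prime p) (p_gt2 : (2 < p)%N) (s t : 'F_p).
Hypothesis st0 : t + t - s != 0.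
Let K : nat := nat_of_ord (t + t - s).
Local Notation code := (loop_code p K).

Let p21 : (1 < p ^ 2)%N.
Proof. by rewrite -(exp1n 2) ltn_exp2r // prime_gt1. Qed.

Let p31 : (1 < p ^ 3)%N.
Proof. by rewrite -(exp1n 3) ltn_exp2r // prime_gt1. Qed.

Lemma exponent_twloop (d : twist_data p) n :
  exponent_dvd n (twloop d s t) = [forall x : d, x *+ n == 0].
Proof. by apply: eq_forallb => x; rewrite lpow_twloop. Qed.

Lemma model_iota1_inj : injective (@model_iota1 p).
Proof. by move=> a b []. Qed.

Lemma Zp_natr_eq0 n m : (1 < n)%N -> (m%:R == 0 :> 'Z_n) = (n %| m)%N.
Proof.
by move=> n1; rewrite -(inj_eq val_inj) /= val_Zp_nat // /dvdn.
Qed.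

Lemma model_iota2_inj : injective (@model_iota2 p).
Proof.
apply: morph_inj; first exact: model_iota2D.
move=> a [/(congr1 val)]; rewrite -mulrnA => /val_inj /eqP.
rewrite Zp_natr_eq0 // -mulnn dvdn_pmul2l ?prime_gt0 // -(Fp_natr_eq0 _ p_prime).
by rewrite natr_Zp => /eqP.
Qed.

Lemma modelE1_exponent (x : modelE1 p) : x *+ p = 0.
Proof.
have h : [/\ (x *+ p).1 = x.1 *+ p, (x *+ p).2.1 = x.2.1 *+ p
   & (x *+ p).2.2 = x.2.2 *+ p].
  by split; [apply: (morphMn (f := fun y : modelE1 p => y.1)) |
    apply: (morphMn (f := fun y : modelE1 p => y.2.1)) |
    apply: (morphMn (f := fun y : modelE1 p => y.2.2))].
move: h; rewrite !mulrn_Fp0 //; case: (x *+ p) => [a [b c]] /= [-> -> ->].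
by [].
Qed.

Lemma modelE2_mulp (x : modelE2 p) : x *+ p = model_iota2 (model_proj2 x).
Proof.
have h1 : (x *+ p).1 = x.1 *+ p by apply: (morphMn (f := fun y : modelE2 p => y.1)).
have h2 : (x *+ p).2 = x.2 *+ p by apply: (morphMn (f := fun y : modelE2 p => y.2)).
case: (x *+ p) h1 h2 => a b /= -> ->; rewrite mulrn_Fp0 // /model_iota2; congr pair.
rewrite /model_proj2 val_Fp_nat // mulrn_modn; last by rewrite -mulrnA mulnn pchar_Zp.
by rewrite -mulrnA mulnC mulrnA natr_Zp.
Qed.

Lemma modelE2_mulp0 (x : modelE2 p) : (x *+ p == 0) = (model_proj2 x == 0).
Proof.
rewrite modelE2_mulp -(morphD0 (@model_iota2D p p_prime)) inj_eq //.
exact: model_iota2_inj.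
Qed.

Lemma model1_00_code : code (twloop (model1 0 0) s t) = 0%N.
Proof.
rewrite /loop_code.
have -> : right_alternative (twloop (model1 0 0 : twist_data p) s t).
  apply/forallP=> x; apply/forallP=> y; apply: right_alt_twloop0.
  by rewrite /= /model_tau !mul0r addr0 mulr0.
by rewrite exponent_twloop (_ : [forall _, _]) //; apply/forallP=> x; rewrite modelE1_exponent.
Qed.

Lemma model1_10_code : code (twloop (model1 1 0) s t) = 3%N.
Proof.
rewrite /loop_code.
have -> : right_alternative (twloop (model1 1 0 : twist_data p) s t) = false.
  apply/negbTE/forallPn; pose x : modelE1 p := (1, (0, 0)).
  pose y : modelE1 p := (0, (1, 0)).
  exists x; apply/forallPn; exists y.
  rewrite right_alt_twloop //; last exact: model_iota1_inj.
  rewrite /= /model_tau /= !(mul0r, mulr0, mul1r, mulr1, addr0, sub0r, add0r).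
  by rewrite oppr_eq0 oner_eq0.
by rewrite exponent_twloop (_ : [forall _, _]) //; apply/forallP=> x; rewrite modelE1_exponent.
Qed.

Let v1 : modelE2 p := (1, 0).
Let v2 : modelE2 p := (0, 1).

Let q_v1 : model_proj2 v1 = 1.
Proof. by rewrite /model_proj2 /= modn_small. Qed.

Let q_v2 : model_proj2 v2 = 0.
Proof. by []. Qed.

Lemma model2_exponent l1 l2 :
  exponent_dvd p (twloop (model2 p_prime l1 l2) s t) = false.
Proof.
rewrite exponent_twloop; apply/negbTE/forallPn.
by exists v1; rewrite modelE2_mulp0 q_v1 oner_eq0.
Qed.

Lemma model2_exponent2 l1 l2 :
  exponent_dvd (p ^ 2) (twloop (model2 p_prime l1 l2) s t).
Proof.
rewrite exponent_twloop; apply/forallP=> x; rewrite -mulnn mulrnA.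
by rewrite modelE2_mulp0 modelE2_mulp model_proj2_iota.
Qed.

Lemma model2_right_alt l1 l2 (x y : modelE2 p) :
  right_alt (y : twloop (model2 p_prime l1 l2) s t) x =
  ((model_proj2 y * x.2 - y.2 * model_proj2 x) * (l1 * model_proj2 x + l2 * x.2) == 0).
Proof. by rewrite right_alt_twloop //; apply: model_iota2_inj. Qed.

Lemma model2_00_code : code (twloop (model2 p_prime 0 0) s t) = 1%N.
Proof.
rewrite /loop_code model2_exponent model2_exponent2.
have -> // : right_alternative (twloop (model2 p_prime 0 0) s t).
apply/forallP=> x; apply/forallP=> y.
by rewrite model2_right_alt !mul0r addr0 mulr0.
Qed.

Lemma model2_not_right_alternative l1 l2 : (l1 != 0) || (l2 != 0) ->
  right_alternative (twloop (model2 p_prime l1 l2) s t) = false.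
Proof.
move=> l0; apply/negbTE/negP => /forallP H.
(* The associator at (v2,v1,v1) detects l1 and the one at (v1,v2,v2) detects l2. *)
have /forallP /(_ v2) := H v1; have /forallP /(_ v1) := H v2.
rewrite !model2_right_alt q_v1 q_v2 /=.
rewrite !(mul0r, mulr0, mul1r, mulr1, addr0, sub0r, add0r, subr0).
by rewrite mulN1r oppr_eq0 => z2; move: l0; rewrite z2 orbF => /negPf ->.
Qed.

Lemma model2_10_code : code (twloop (model2 p_prime 1 0) s t) = 4%N.
Proof.
rewrite /loop_code model2_exponent model2_not_right_alternative ?oner_eq0 //.
have -> // : right_alternative_mod p (twloop (model2 p_prime 1 0) s t).
apply/forallP=> x; apply/implyP; rewrite lpow_twloop modelE2_mulp0 => /eqP x0.
by apply/forallP=> y; rewrite model2_right_alt x0 !mul0r !mulr0 addr0 mulr0.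
Qed.

Lemma model2_0_not_right_alternative_mod l2 : l2 != 0 ->
  right_alternative_mod p (twloop (model2 p_prime 0 l2) s t) = false.
Proof.
move=> l0; apply/negbTE/negP => /forallP /(_ v2) /implyP.
rewrite lpow_twloop modelE2_mulp0 q_v2 eqxx => /(_ isT) /forallP /(_ v1).
rewrite model2_right_alt q_v1 q_v2.
by rewrite !(mul0r, mulr0, mul1r, mulr1, addr0, sub0r, add0r, subr0) (negPf l0).
Qed.

Local Notation M l2 := (twloop (model2 p_prime 0 l2) s t).

Lemma model2_square_associator l2 :
  square_associator p K (M l2) =
  [exists b : 'F_p, b ^+ 2 * l2 == 1].
Proof.
have assocE (x y : M l2) : model_proj2 y = 0 ->
    (x ⋅ (y ⋅ y) == ((x ⋅ y) ⋅ y) ⋅ lpow K (lpow p x)) =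
    (model_proj2 x * ((y : modelE2 p).2 ^+ 2 * l2) == model_proj2 x).
  move=> y0; have -> : lpow K (lpow p x) =
      model_iota2 ((t + t - s) * model_proj2 x) :> M l2.
    rewrite !lpow_twloop modelE2_mulp.
    exact/esym/(Fp_morphZ _ _ (@model_iota2D p p_prime)).
  rewrite twloop_assoc_sqr (inj_eq (@lmulI (M l2) _)) (inj_eq model_iota2_inj).
  rewrite (inj_eq (mulfI st0)) /= /model_tau y0.
  by congr (_ == _); ring.
apply/existsP/existsP => [[x /existsP [y /and3P [y0 x0 E]]]|[b /eqP Eb]].
  move: y0; rewrite lpow_twloop modelE2_mulp0 => /eqP y0.
  move: x0; rewrite lpow_twloop modelE2_mulp0 => x0.
  move: E; rewrite assocE // => /eqP E.
  by exists (y : modelE2 p).2; apply/eqP/(mulfI x0); rewrite E mulr1.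
exists v1; apply/existsP; exists ((0, b) : modelE2 p); apply/and3P; split.
- by rewrite lpow_twloop modelE2_mulp0.
- by rewrite lpow_twloop modelE2_mulp0 q_v1 oner_eq0.
- by rewrite assocE // q_v1 Eb mulr1.
Qed.

Lemma model2_01_code : code (twloop (model2 p_prime 0 1) s t) = 5%N.
Proof.
rewrite /loop_code model2_exponent model2_not_right_alternative ?oner_eq0 ?orbT //.
rewrite model2_0_not_right_alternative_mod ?oner_eq0 // model2_square_associator.
have -> // : [exists b : 'F_p, b ^+ 2 * 1 == 1].
by apply/existsP; exists 1; rewrite expr1n mulr1.
Qed.

Lemma model2_0n_code : code (twloop (model2 p_prime 0 (nonsquare p)) s t) = 6%N.
Proof.
have n0 := nonsquare_neq0 p_prime p_gt2.
rewrite /loop_code model2_exponent model2_not_right_alternative ?n0 ?orbT //.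
rewrite model2_0_not_right_alternative_mod // model2_square_associator.
have -> // : [exists b : 'F_p, b ^+ 2 * nonsquare p == 1] = false.
apply/negbTE/existsPn => b; apply/eqP => E.
have := nonsquareP p_prime p_gt2 b^-1; rewrite exprVn => /eqP; apply.
exact: mulr1_eq.
Qed.

Lemma model3_code : code (twloop (model3 p) s t) = 2.
Proof.
rewrite /loop_code.
have -> : right_alternative (twloop (model3 p) s t).
  apply/forallP=> x; apply/forallP=> y; apply: right_alt_twloop0.
  by rewrite /= /model_tau !mul0r addr0 mulr0.
have exp_false n : (0 < n < p ^ 3)%N -> exponent_dvd n (twloop (model3 p) s t) = false.
  move=> /andP [n0 n3]; rewrite exponent_twloop; apply/negbTE/forallPn.
  exists (1 : 'Z_(p ^ 3)); rewrite (Zp_natr_eq0 _ p31).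
  by rewrite gtnNdvd.
have p1 := prime_gt1 p_prime.
rewrite !exp_false // ?expn_gt0 ?prime_gt0 //=; first by rewrite ltn_exp2l.
by rewrite -{1}(expn1 p) ltn_exp2l.
Qed.

Definition model_list : seq (twist_data p) := [:: model1 0 0; model2 p_prime 0 0;
  model3 p; model1 1 0; model2 p_prime 1 0; model2 p_prime 0 1;
  model2 p_prime 0 (nonsquare p)].

Definition model_loop (i : 'I_7) : finLoop := twloop (nth (model3 p) model_list i) s t.

Lemma model_loop_code i : code (model_loop i) = i.
Proof.
case: i => [] [|[|[|[|[|[|[|//]]]]]]] Hi; rewrite /model_loop /=.
- exact: model1_00_code.
- exact: model2_00_code.
- exact: model3_code.
- exact: model1_10_code.
- exact: model2_10_code.
- exact: model2_01_code.
- exact: model2_0n_code.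
Qed.

Lemma model_loop_card i : #|model_loop i| = (p ^ 3)%N.
Proof.
have c1 := card_modelE1 p_prime; have c2 := card_modelE2 p_prime.
have c3 := card_modelE3 p_prime.
by case: i => [] [|[|[|[|[|[|[|//]]]]]]] Hi.
Qed.

Lemma twist_form_model (L : finLoop) : #|L| = (p ^ 3)%N ->
  has_twist_form s t L -> exists i, loop_isomorphic (model_loop i) L.
Proof.
move=> cL [d [Ld]]; rewrite cL => cd Hd.
suff [i Hi] : exists i, loop_isomorphic (model_loop i) (twloop d s t).
  by exists i; apply: loop_isomorphic_trans Hi (loop_isomorphic_sym Ld).
have at_ (i : nat) (Hi : (i < 7)%N) :
    loop_isomorphic (twloop (nth (model3 p) model_list i) s t) (twloop d s t) ->
    exists i, loop_isomorphic (model_loop i) (twloop d s t).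
  by move=> H; exists (Ordinal Hi).
have [/forallP tau0|] := boolP [forall x : d, forall y : d, forall z : d, td_tau x y z == 0].
  have {}tau0 (x y z : d) : td_tau x y z = 0.
    by have /forallP /(_ y) /forallP /(_ z) /eqP := tau0 x.
  have iso (m : twist_data p) (f : m -> d) : injective f -> {morph f : x y / x + y} ->
      #|m| = (p ^ 3)%N -> (forall x y z : m, td_tau x y z = 0) ->
      loop_isomorphic (twloop m s t) (twloop d s t).
    move=> fI fD cm m0; apply: (twloop_isomorphic _ _ fI) => //; first by rewrite cm cd.
    by move=> x y z; rewrite m0 tau0 !td_iota0 (morphD0 fD).
  have [[f fI fD]|[f fI fD]|[f fI fD]] := abelian_model_cases p_prime cd.
  - apply: (@at_ 0%N) => //; apply: (iso (model1 0 0) f) => //.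
      exact: card_modelE1.
    by move=> x y z; rewrite /= /model_tau !mul0r addr0 mulr0.
  - apply: (@at_ 1%N) => //; apply: (iso (model2 p_prime 0 0) f) => //.
      exact: card_modelE2.
    by move=> x y z; rewrite /= /model_tau !mul0r addr0 mulr0.
  - apply: (@at_ 2) => //; apply: (iso (model3 p) f) => //.
      exact: card_modelE3.
    by move=> x y z; rewrite /= /model_tau !mul0r addr0 mulr0.
rewrite negb_forall => /existsP [u]; rewrite negb_forall => /existsP [v].
rewrite negb_forall => /existsP [w t0].
have iI : injective (@td_iota p d).
  by case: Hd => // tau0; rewrite tau0 eqxx in t0.
have [H|H|H|H] := twist_normal_form p_prime p_gt2 cd iI t0 s t.
- exact: (@at_ 3).
- exact: (@at_ 4).
- exact: (@at_ 5).
- exact: (@at_ 6).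
Qed.

End ModelCodes.

Close Scope ring_scope.

(** * Counting isomorphism classes *)

Lemma iso_class_eq L M : loop_isomorphic L M <-> iso_class L = iso_class M.
Proof.
split=> [LM|E]; last first.
  by have : iso_class M M := loop_isomorphic_refl M; rewrite -E.
apply/funext => N; apply/propext; split=> H.
  exact: loop_isomorphic_trans (loop_isomorphic_sym LM) H.
exact: loop_isomorphic_trans LM H.
Qed.

(** The count for both classes at once: the codes separate the models, and the twist form puts every
    loop in one of their classes. *)
Lemma seven_iso_classes p (s t : 'F_p) (P : finLoop -> Prop) :
  prime p -> (2 < p)%N -> (t + t - s != 0)%R -> (forall d, P (twloop d s t)) ->
  (forall L : finLoop, #|L| = (p ^ 3)%N -> P L -> has_twist_form s t L) ->
  exists f : 'I_7 -> iso_classes P (p ^ 3), bijective f.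
Proof.
move=> pr p2 st0 Pd PL; pose m := model_loop pr s t.
have codeK i : loop_code p (t + t - s)%R (m i) = i := model_loop_code pr p2 st0 i.
have mP i : exists L, [/\ P L, #|L| = (p ^ 3)%N & iso_class (m i) = iso_class L].
  by exists (m i); split; [apply: Pd | apply: model_loop_card |].
have classP (C : iso_classes P (p ^ 3)) : exists i, iso_class (m i) = sval C.
  case: C => /= C [L [LP Lp ->]].
  have [i Hi] := twist_form_model pr p2 Lp (PL L Lp LP).
  by exists i; apply/iso_class_eq.
pose g C := sval (cid (classP C)).
have gK C : iso_class (m (g C)) = sval C := svalP (cid (classP C)).
exists (fun i => exist _ (iso_class (m i)) (mP i)); exists g => [i|C].
  have /iso_class_eq /(loop_code_isomorphic p (t + t - s)%R) := gK (exist _ _ (mP i)).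
  by rewrite !codeK => /ord_inj.
by move: (gK C); move: (g C) => i; case: C => C CP /= E; apply: eq_exist.
Qed.

Theorem proposition5p13 (p : nat) (p_prime : prime p) (p_gt3 : 3 < p) :
  (exists f : 'I_7 -> iso_classes bruck_loop (p ^ 3), bijective f) /\
  (exists g : iso_classes bruck_loop (p ^ 3) ->
              iso_classes commutative_automorphic_loop (p ^ 3), bijective g).
Proof.
have p2 : 2 < p by apply: leq_trans p_gt3.
have n3 : (3%:R != 0 :> 'F_p)%R by apply: Fp_nat_neq0.
have [f fB] : exists f : 'I_7 -> iso_classes bruck_loop (p ^ 3), bijective f.
  apply: (@seven_iso_classes p 1%R (1 + 1)%R) => //.
  (* The scalar 2t - s is 3 for Bruck loops, and -3 for commutative automorphic loops below. *)
  - by rewrite (_ : _ - _ = 3%:R)%R //; ring.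
  - by move=> d; apply: tw_bruck.
  - by move=> L cL bL; apply: bruck_twist_form.
have [h hB] : exists h : 'I_7 -> iso_classes commutative_automorphic_loop (p ^ 3),
    bijective h.
  apply: (@seven_iso_classes p 1%R (- 1)%R) => //.
  - by rewrite (_ : _ - _ = - 3%:R)%R ?oppr_eq0 //; ring.
  - by move=> d; apply: tw_ca.
  - by move=> L cL caL; apply: ca_twist_form.
split; first by exists f.
have [f' fK f'K] := fB; exists (h \o f').
by apply: bij_comp => //; exists f.
Qed.
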